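(* Let $N\ge2$, let $\Omega\subset\mathbb{R}^N$ be a convex bounded open set and let $\varphi:\partial\Omega\to\mathbb{R}$ satisfy the bounded slope condition of rank $K$. Then there exist a sequence $\{\Omega_k\}_{k}$ of smooth bounded uniformly convex open subsets of $\mathbb{R}^N$ and a sequence of $(K+1)$-Lipschitz functions $\varphi_k:\mathbb{R}^N\to\mathbb{R}$ (indexed by the positive integers $k$) such that: (i) $\Omega\Subset\Omega_k$ for every $k$, $$\mathrm{diam}\,\Omega_k\le\mathrm{diam}\,\Omega+\frac{8\,\beta_\Omega}{k},\qquad \lim_{k\to+\infty}|\Omega_k\setminus\Omega|=0,$$ and $$\lim_{k\to+\infty}\left[\max_{y\in\partial\Omega}\ \min_{y'\in\partial\Omega_k}|y-y'|\right]=0;$$ (ii) $\varphi_k|_{\partial\Omega_k}$ is smooth and satisfies the bounded slope condition of rank $K+2$ (on $\partial\Omega_k$); (iii) $\varphi_k$ coincides with $\varphi$ on $\partial\Omega$.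
   Context: Bounded slope condition: for a bounded open set $\Omega\subset\mathbb{R}^N$ and $K>0$, a map $\varphi:\partial\Omega\to\mathbb{R}$ satisfies the bounded slope condition of rank $K$ if for every $y\in\partial\Omega$ there exist $\zeta_y^-,\zeta_y^+\in\mathbb{R}^N$ with $|\zeta_y^-|,|\zeta_y^+|\le K$ and $$\varphi(y)+\langle\zeta_y^-,x-y\rangle\le\varphi(x)\le\varphi(y)+\langle\zeta_y^+,x-y\rangle\qquad\text{for every }x\in\partial\Omega.$$ The constant $\beta_\Omega$ depends only on $\Omega$: fixing a point $x_0\in\Omega$, $$\beta_\Omega=\frac12\,\frac{\max_{y\in\partial\Omega}|x_0-y|}{\min_{y\in\partial\Omega}|x_0-y|}.$$ A smooth bounded convex open set is uniformly convex if the principal curvatures of its boundary are bounded below by a positive constant. $|E|$ denotes the Lebesgue measure of $E$, and $\Omega\Subset\Omega_k$ means $\overline\Omega\subset\Omega_k$. *)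

(* Defs.v *)
From HB Require Import structures.
From mathcomp Require Import all_boot all_order all_algebra.
From mathcomp Require Import all_classical all_reals all_analysis.

Set Implicit Arguments.
Unset Strict Implicit.
Unset Printing Implicit Defensive.

Import Order.TTheory GRing.Theory Num.Theory.
Import numFieldNormedType.Exports.

Local Open Scope classical_set_scope.
Local Open Scope ring_scope.

(* R^N is 'rV[R]_N. The norm `| _ | of the library on 'rV[R]_N is the sup norm;
   it induces the usual topology and bounded sets, but every metric quantity
   below goes through the Euclidean norm [enorm]. *)

Definition dot (R : realType) (N : nat) (u v : 'rV[R]_N) : R :=
  \sum_(i < N) u ord0 i * v ord0 i.

Definition enorm (R : realType) (N : nat) (u : 'rV[R]_N) : R :=
  Num.sqrt (dot u u).

Definition edist (R : realType) (N : nat) (x y : 'rV[R]_N) : R := enorm (x - y).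

Definition frontier (T : topologicalType) (A : set T) : set T :=
  closure A `\` A°.

(* [sup] and [inf] are the library's total operations on sets of reals. Below
   they are applied to images of nonempty compact sets under continuous
   functions, where they are the maximum and the minimum; for [diam], to a
   nonempty bounded set. *)
Definition diam (R : realType) (N : nat) (A : set 'rV[R]_N) : R :=
  sup [set edist p.1 p.2 | p in A `*` A].

Definition max_dist (R : realType) (N : nat) (x : 'rV[R]_N) (A : set 'rV[R]_N)
    : R :=
  sup [set edist x y | y in A].

Definition min_dist (R : realType) (N : nat) (x : 'rV[R]_N) (A : set 'rV[R]_N)
    : R :=
  inf [set edist x y | y in A].

Definition max_min_dist (R : realType) (N : nat) (A B : set 'rV[R]_N) : R :=
  sup [set min_dist y B | y in A].

Definition beta (R : realType) (N : nat) (Omega : set 'rV[R]_N)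
    (x0 : 'rV[R]_N) : R :=
  2^-1 * (max_dist x0 (frontier Omega) / min_dist x0 (frontier Omega)).

(* phi is a function on the whole space of which only the values on the
   boundary of Omega matter. *)
Definition bounded_slope_condition (R : realType) (N : nat)
    (Omega : set 'rV[R]_N) (K : R) (phi : 'rV[R]_N -> R) : Prop :=
  forall y, frontier Omega y ->
    exists zm zp : 'rV[R]_N,
      [/\ enorm zm <= K, enorm zp <= K &
          forall x, frontier Omega x ->
            phi y + dot zm (x - y) <= phi x <= phi y + dot zp (x - y)].

Definition elipschitz (R : realType) (N : nat) (L : R) (f : 'rV[R]_N -> R)
    : Prop :=
  forall x y, `|f x - f y| <= L * edist x y.

(* Lebesgue measure on R^N: the N-fold product of the one-dimensional Lebesgue
   measure, on the product sigma-algebra of N-tuples. *)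
Definition tuple_of_pair (R : realType) (n : nat)
    (p : n.-tuple (measurableTypeR R) * measurableTypeR R)
    : n.+1.-tuple (measurableTypeR R) :=
  [tuple of p.2 :: p.1].

Lemma measurable_tuple_of_pair (R : realType) (n : nat) :
  measurable_fun [set: _] (@tuple_of_pair R n).
Proof.
exact: measurable_cons measurable_snd measurable_fst.
Qed.

Definition next_measure (R : realType) (n : nat)
    (mu : {measure set (n.-tuple (measurableTypeR R)) -> \bar R}) :=
  pushforward (mu \x @lebesgue_measure R)%E (@tuple_of_pair R n).

HB.instance Definition _ R n mu := Measure.copy (@next_measure R n mu)
  (measure_function_pushforward__canonical__measure_function_Measure
    (mu \x @lebesgue_measure R)%E (@measurable_tuple_of_pair R n)).

Fixpoint lebesgue_tuple (R : realType) (n : nat)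
    : {measure set (n.-tuple (measurableTypeR R)) -> \bar R} :=
  if n is n'.+1 then next_measure (lebesgue_tuple R n') else \d_([tuple]).

Definition lebesgue (R : realType) (N : nat) (A : set 'rV[R]_N) : \bar R :=
  lebesgue_tuple R N [set t | A (\row_i tnth t i)].

Definition basis_vec (R : realType) (N : nat) (i : 'I_N) : 'rV[R]_N :=
  delta_mx ord0 i.

Fixpoint partials (R : realType) (N : nat) (s : seq 'I_N) (f : 'rV[R]_N -> R)
    : 'rV[R]_N -> R :=
  if s is i :: s' then 'D_(basis_vec R i) (partials s' f) else f.

(* C^infinity on an open set U: the partial derivatives of all orders exist and
   are continuous at every point of U. *)
Definition smooth_on (R : realType) (N : nat) (U : set 'rV[R]_N)
    (f : 'rV[R]_N -> R) : Prop :=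
  forall (s : seq 'I_N) x, U x ->
    {for x, continuous (partials s f)} /\
    forall i, derivable (partials s f) x (basis_vec R i).

Definition grad (R : realType) (N : nat) (f : 'rV[R]_N -> R) (x : 'rV[R]_N)
    : 'rV[R]_N :=
  \row_i 'D_(basis_vec R i) f x.

Definition local_defining (R : realType) (N : nat) (Omega : set 'rV[R]_N)
    (y : 'rV[R]_N) (U : set 'rV[R]_N) (rho : 'rV[R]_N -> R) : Prop :=
  [/\ open U, U y, smooth_on U rho, (forall x, U x -> grad rho x != 0) &
      Omega `&` U = [set x | U x /\ rho x < 0]].

Definition smooth_boundary (R : realType) (N : nat) (Omega : set 'rV[R]_N)
    : Prop :=
  forall y, frontier Omega y -> exists U rho, local_defining Omega y U rho.

(* On the boundary, the outward unit normal; [rho] extends it to a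
   neighbourhood. *)
Definition normal_field (R : realType) (N : nat) (rho : 'rV[R]_N -> R)
    (x : 'rV[R]_N) : 'rV[R]_N :=
  (enorm (grad rho x))^-1 *: grad rho x.

(* kappa is an eigenvalue of the Weingarten map at y, that is of the
   differential of the outward unit normal on the tangent space at y. As tangent
   derivatives only see the values on the boundary, this does not depend on rho.
   The sign makes the curvatures of a ball of radius r equal to 1 / r. *)
Definition principal_curvature (R : realType) (N : nat)
    (Omega : set 'rV[R]_N) (y : 'rV[R]_N) (kappa : R) : Prop :=
  exists U rho, local_defining Omega y U rho /\
    exists v : 'rV[R]_N,
      [/\ v != 0, dot (grad rho y) v = 0 &
          'D_v (normal_field rho) y = kappa *: v].

Definition smooth_uniformly_convex (R : realType) (N : nat)
    (Omega : set 'rV[R]_N) : Prop :=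
  [/\ open Omega, bounded_set Omega,
      convex_set (Omega : set (convex_lmodType 'rV[R]_N)),
      smooth_boundary Omega &
      exists2 c : R, 0 < c &
        forall y kappa, frontier Omega y ->
          principal_curvature Omega y kappa -> c <= kappa].

(* The restriction of f to the hypersurface "boundary of Omega" is smooth: it
   has a smooth extension near every boundary point. *)
Definition smooth_on_frontier (R : realType) (N : nat) (Omega : set 'rV[R]_N)
    (f : 'rV[R]_N -> R) : Prop :=
  forall y, frontier Omega y ->
    exists U g, [/\ open U, U y, smooth_on U g &
      forall x, U x -> frontier Omega x -> g x = f x].

(* Main.v *)
(* The bounded slope condition provides affine functions below and above [phi]
   on the boundary of Omega, touching it at a given boundary point. Add to them
   half a supporting affine function of Omega, so that slightly outside Omega
   the lower one exceeds the upper one. The logarithm of the mean of the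
   exponentials of finitely many of the lower functions, plus a small multiple
   of sqrt (1 + |x|^2), is a smooth, locally strongly convex and
   (K + 1)-Lipschitz function [gl] with [gl < phi] on the boundary of Omega.
   The upper functions give in the same way a concave function [- gu] with
   [phi < - gu] there. Take {gl < - gu} as the approximating domain and
   max (gl, min (- gu, f)) as the approximating datum, where [f] is any
   K-Lipschitz extension of [phi]: on the boundary of the domain the datum is
   equal both to the convex [gl] and to the concave [- gu], hence satisfies the
   bounded slope condition with the subgradients as slopes. *)

Require Import Defs.
From mathcomp Require Import all_boot all_order all_algebra.
From mathcomp Require Import all_classical all_reals all_analysis.
From mathcomp Require Import measurable_realfun ring lra.
Set Implicit Arguments.
Unset Strict Implicit.
Unset Printing Implicit Defensive.
Import Order.TTheory GRing.Theory Num.Theory.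
Import numFieldNormedType.Exports.
Local Open Scope classical_set_scope.
Local Open Scope ring_scope.

(* [edist] alone is the extended distance of MathComp-Analysis. *)
Local Notation edist := Defs.edist.

(** The bounded slope condition must hold on a boundary where [phi] is not given, so regularising
    domain and datum separately would leave the slopes uncontrolled. Taking for boundary the set
    where a convex function meets a concave one yields domain, datum and slopes together.

    Constants: the given slopes have norm at most K, half an affine function with slope of norm at
    most 1 adds 1/2, and smoothing spends at most another 1/2, whence K + 1.

    All of (i) comes from one sandwich: the closure of Omega lies in the new domain, which lies in
    the image of Omega under the homothety of centre x0 and ratio 1 + t, with t small. Therefore the
    lower functions need to exceed the upper ones only at the points x0 + (1 + t)(a - x0) with a on
    the boundary, and compactness reduces these to finitely many contact points. The volume also
    needs that the boundary of a convex open set is null.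

    A second obstacle is that curvatures are defined through arbitrary local defining functions.
    Strong convexity of [gl] + [gu] is therefore first turned into a quadratic inequality for the
    points of the domain, which every defining function has to respect. *)

Section Euclidean.

(** * Euclidean inner product and norm, and the topology they induce *)

Context {R : realType} {N : nat}.
Implicit Types (u v w x y : 'rV[R]_N) (a b : R).

Lemma dotC u v : dot u v = dot v u.
Proof. by apply: eq_bigr => i _; rewrite mulrC. Qed.

Lemma dotDl u v w : dot (u + v) w = dot u w + dot v w.
Proof. by rewrite -big_split; apply: eq_bigr => i _; rewrite mxE mulrDl. Qed.

Lemma dotZl a u v : dot (a *: u) v = a * dot u v.
Proof. by rewrite mulr_sumr; apply: eq_bigr => i _; rewrite mxE mulrA. Qed.

Lemma dotDr u v w : dot w (u + v) = dot w u + dot w v.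
Proof. by rewrite dotC dotDl !(dotC w). Qed.

Lemma dotZr a u v : dot u (a *: v) = a * dot u v.
Proof. by rewrite dotC dotZl dotC. Qed.

Lemma dotNl u v : dot (- u) v = - dot u v.
Proof. by rewrite -scaleN1r dotZl mulN1r. Qed.

Lemma dotNr u v : dot u (- v) = - dot u v.
Proof. by rewrite dotC dotNl dotC. Qed.

Lemma dotBl u v w : dot (u - v) w = dot u w - dot v w.
Proof. by rewrite dotDl dotNl. Qed.

Lemma dotBr u v w : dot w (u - v) = dot w u - dot w v.
Proof. by rewrite dotDr dotNr. Qed.

Lemma dot0l u : dot 0 u = 0.
Proof. by rewrite -(scale0r u) dotZl mul0r. Qed.

Lemma dot0r u : dot u 0 = 0.
Proof. by rewrite dotC dot0l. Qed.

Definition dotE := (dotDl, dotDr, dotNl, dotNr, dotZl, dotZr, dot0l, dot0r).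

Lemma dot_suml (I : Type) (r : seq I) (P : pred I) (F : I -> 'rV[R]_N) v :
  dot (\sum_(i <- r | P i) F i) v = \sum_(i <- r | P i) dot (F i) v.
Proof.
by rewrite (big_morph (fun x => dot x v) (fun x y => dotDl x y v) (dot0l v)).
Qed.

Lemma dotxx_ge0 u : 0 <= dot u u.
Proof. by apply: sumr_ge0 => i _; rewrite -expr2 sqr_ge0. Qed.

Lemma dotxx_eq0 u : (dot u u == 0) = (u == 0).
Proof.
apply/idP/idP => [|/eqP->]; last by rewrite dot0l.
rewrite psumr_eq0 => [/allP h|i _]; last by rewrite -expr2 sqr_ge0.
apply/eqP/rowP => i; rewrite mxE; have := h i (mem_index_enum _).
by rewrite -expr2 sqrf_eq0 => /eqP.
Qed.

Lemma dotxx_gt0 u : (0 < dot u u) = (u != 0).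
Proof. by rewrite lt_neqAle dotxx_ge0 andbT eq_sym dotxx_eq0. Qed.

Lemma enorm_ge0 u : 0 <= enorm u.
Proof. exact: sqrtr_ge0. Qed.

Lemma enormK u : enorm u ^+ 2 = dot u u.
Proof. exact/sqr_sqrtr/dotxx_ge0. Qed.

Lemma enorm_gt0 u : (0 < enorm u) = (u != 0).
Proof. by rewrite sqrtr_gt0 dotxx_gt0. Qed.

Lemma enorm0 : enorm (0 : 'rV[R]_N) = 0.
Proof. by rewrite /enorm dot0l sqrtr0. Qed.

Lemma enormZ a u : enorm (a *: u) = `|a| * enorm u.
Proof.
by rewrite /enorm dotZl dotZr mulrA -expr2 sqrtrM ?sqr_ge0// sqrtr_sqr.
Qed.

Lemma enormN u : enorm (- u) = enorm u.
Proof. by rewrite -scaleN1r enormZ normrN1 mul1r. Qed.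

Lemma edistC x y : edist x y = edist y x.
Proof. by rewrite /edist -enormN opprB. Qed.

Lemma edistxx x : edist x x = 0.
Proof. by rewrite /edist subrr enorm0. Qed.

Lemma dot_le_enorm u v : dot u v <= enorm u * enorm v.
Proof.
have [->|u0] := eqVneq u 0; first by rewrite dot0l enorm0 mul0r.
have h : dot u v ^+ 2 <= (enorm u * enorm v) ^+ 2.
  have := dotxx_ge0 (dot u u *: v - dot u v *: u).
  rewrite !dotE (dotC v u) exprMn !enormK => h.
  have uu : 0 < dot u u by rewrite dotxx_gt0.
  rewrite -(ler_pM2l uu); nra.
apply: le_trans (ler_norm _) _.
rewrite -(ler_pXn2r (n := 2))// ?nnegrE ?mulr_ge0 ?enorm_ge0//.
by rewrite -normrX ger0_norm ?sqr_ge0.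
Qed.

Lemma norm_dot_le u v : `|dot u v| <= enorm u * enorm v.
Proof.
rewrite ler_norml dot_le_enorm andbT lerNl -dotNl -(enormN u).
exact: dot_le_enorm.
Qed.

Lemma enormD u v : enorm (u + v) <= enorm u + enorm v.
Proof.
rewrite -(ler_pXn2r (n := 2))// ?nnegrE ?addr_ge0 ?enorm_ge0//.
rewrite enormK !dotE sqrrD !enormK (dotC v u).
have := dot_le_enorm u v; lra.
Qed.

Lemma edist_triangle z x y : edist x y <= edist x z + edist z y.
Proof. by rewrite /edist (le_trans _ (enormD _ _))// subrKA. Qed.

Lemma norm_coord_le u i : `|u ord0 i| <= `|u|.
Proof.
rewrite [leRHS]/Num.norm/= mx_normrE.
by have := le_bigmax 0 (fun ij : 'I_1 * 'I_N => `|u ij.1 ij.2|) (ord0, i).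
Qed.

Lemma norm_coord_enorm u i : `|u ord0 i| <= enorm u.
Proof.
rewrite -(ler_pXn2r (n := 2))// ?nnegrE ?enorm_ge0// enormK -normrX.
rewrite ger0_norm ?sqr_ge0// /dot (bigD1 i)//= -expr2 lerDl.
by apply: sumr_ge0 => j _; rewrite -expr2 sqr_ge0.
Qed.

Lemma norm_le_enorm u : `|u| <= enorm u.
Proof.
rewrite [leLHS]/Num.norm/= mx_normrE bigmax_le ?enorm_ge0// => -[i j] _ /=.
by rewrite ord1 norm_coord_enorm.
Qed.

Lemma enorm_le_norm u : enorm u <= N%:R * `|u|.
Proof.
rewrite -(ler_pXn2r (n := 2))// ?nnegrE ?enorm_ge0 ?mulr_ge0// enormK.
apply: (@le_trans _ _ (\sum_(i < N) `|u| ^+ 2)).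
  apply: ler_sum => i _; rewrite -expr2 -real_normK ?num_real//.
  by rewrite lerXn2r ?nnegrE ?norm_coord_le.
rewrite sumr_const card_ord exprMn -[_ *+ N]mulr_natl ler_wpM2r ?sqr_ge0//.
by rewrite -natrX ler_nat; case: (N) => // n; rewrite leq_pmulr.
Qed.

(** Topological notions are those of the sup norm; the two comparisons of norms above let every
    later argument use Euclidean balls only. *)
Lemma nbhs_edistP x (A : set 'rV[R]_N) :
  nbhs x A <-> exists2 e, 0 < e & forall y, edist x y < e -> A y.
Proof.
split=> [/nbhs_normP[e /= e0 xA]|[e e0 xA]].
  exists e => // y xy; apply: xA; rewrite /ball_/=.
  exact: le_lt_trans (norm_le_enorm _) xy.
suff h : nbhs_ball_ (ball_ (fun z : 'rV[R]_N => `|z|)) x A.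
  by apply: (nbhs_normP x A).2.
exists (e / (N%:R + 1)) => /=.
  by rewrite divr_gt0// ltr_wpDl.
move=> y; rewrite /ball_/= ltr_pdivlMr ?ltr_wpDl// => xy.
apply: xA; apply: le_lt_trans (enorm_le_norm _) _; apply: le_lt_trans xy.
by rewrite mulrC ler_wpM2l// lerDl.
Qed.

Lemma continuous_edistP (f : 'rV[R]_N -> R) x :
  {for x, continuous f} <->
  forall e, 0 < e ->
    exists2 d, 0 < d & forall y, edist x y < d -> `|f x - f y| < e.
Proof.
split=> [fx e e0|fx].
  apply/nbhs_edistP.
  exact: (@cvgrPdist_lt _ _ _ _ (nbhs_filter x) f (f x)).1 fx e e0.
apply/(@cvgrPdist_lt _ _ _ _ (nbhs_filter x)) => e /fx ?.
exact/nbhs_edistP.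
Qed.

Lemma elipschitz_continuous L (f : 'rV[R]_N -> R) :
  elipschitz L f -> continuous f.
Proof.
move=> fL x; apply/continuous_edistP => e e0.
have L0 : 0 < `|L| + 1 by rewrite ltr_wpDl.
exists (e / (`|L| + 1)); first by rewrite divr_gt0.
move=> y; rewrite ltr_pdivlMr// => xy.
apply: le_lt_trans (fL x y) _; apply: le_lt_trans xy; rewrite mulrC.
by rewrite ler_wpM2l ?enorm_ge0// (le_trans (ler_norm _))// lerDl.
Qed.

End Euclidean.

(** * Convex sets: exit points of segments and separation *)

Section ConvexGeometry.
Context {R : realType} {N : nat}.
Implicit Types (A : set 'rV[R]_N) (x y z u v : 'rV[R]_N) (t : R).

Definition seg x y t := x + t *: (y - x).

Lemma seg0 x y : seg x y 0 = x.
Proof. by rewrite /seg scale0r addr0. Qed.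

Lemma seg1 x y : seg x y 1 = y.
Proof. by rewrite /seg scale1r addrC subrK. Qed.

Lemma segE x y t : seg x y t = (1 - t) *: x + t *: y.
Proof. by rewrite /seg scalerBr scalerBl scale1r -addrA [- _ + _]addrC. Qed.

Lemma edist_seg x y s t : edist (seg x y s) (seg x y t) = `|s - t| * edist x y.
Proof.
rewrite /Defs.edist opprD addrACA subrr add0r -scalerBl enormZ.
by rewrite -[enorm (y - x)]/(edist y x) edistC.
Qed.

Lemma closure_edistP A x :
  closure A x <-> forall e, 0 < e -> exists2 y, A y & edist x y < e.
Proof.
split=> [clA e e0|h B /nbhs_edistP[e /h[y Ay xy] xB]]; last first.
  by exists y; split => //; exact: xB.
have [|y [Ay xy]] := clA [set y | edist x y < e]; last by exists y.
by apply/nbhs_edistP; exists e.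
Qed.

Lemma open_edistP A :
  open A <-> forall x, A x -> exists2 e, 0 < e & forall y, edist x y < e -> A y.
Proof.
split=> [oA x Ax|h].
  by apply/nbhs_edistP; exact: open_nbhs_nbhs.
by rewrite openE => x /h ?; exact/nbhs_edistP.
Qed.

Lemma bounded_enormP A :
  bounded_set A <-> exists2 M, 0 < M & forall x, A x -> enorm x <= M.
Proof.
split=> [[M [_ bM]]|[M M0 AM]].
  exists (N%:R * (`|M| + 1) + 1).
    by rewrite ltr_wpDl// mulr_ge0// addr_ge0.
  move=> x Ax; apply: le_trans (enorm_le_norm _) _.
  rewrite ler_wpDr// ler_wpM2l//; apply: bM => //.
  by rewrite (le_lt_trans (ler_norm _))// ltrDl.
exists M; split; first exact: num_real.
move=> M' MM' x Ax /=; rewrite (le_trans (norm_le_enorm _))//.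
by rewrite (le_trans (AM _ Ax))// ltW.
Qed.

Lemma convex_setP A :
  convex_set (A : set (convex_lmodType 'rV[R]_N)) <->
  forall x y t, 0 <= t <= 1 -> A x -> A y -> A (seg x y t).
Proof.
split=> [cA x y t /andP[t0 t1] Ax Ay|cA x y l].
  have /set_mem := cA y x (Itv01 t0 t1) (mem_set Ay) (mem_set Ax).
  by rewrite segE addrC.
move=> /set_mem Ax /set_mem Ay; apply/mem_set.
have /andP[l0 l1] : 0 <= l%:num <= 1 by rewrite ge0 le1.
have -> : conv l x y = seg y x l%:num by rewrite segE addrC.
by apply: cA => //; rewrite l0.
Qed.

Lemma frontier_openP A x : open A -> frontier A x <-> closure A x /\ ~ A x.
Proof. by move=> oA; rewrite /frontier (interior_id _).1. Qed.

(* The first exit time of the segment is the infimum of the closed set of times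
   at which the segment is outside [A]. *)
Lemma exit_point A x y : open A -> A x -> ~ A y ->
  exists2 t, 0 < t <= 1 & frontier A (seg x y t).
Proof.
move=> oA Ax nAy; pose T := [set t | 0 <= t /\ ~ A (seg x y t)].
have T1 : T 1 by split; rewrite ?seg1.
have lT : has_lbound T by exists 0 => t [].
have nT : nonempty T by exists 1.
pose s := inf T.
have s0 : 0 <= s by apply: lb_le_inf => // t [].
have sin t : 0 <= t -> t < s -> A (seg x y t).
  move=> t0 ts; apply: contrapT => nA.
  by have /(_ _ (conj t0 nA)) := ge_inf lT; rewrite leNgt ts.
have d0 : 0 <= edist x y := enorm_ge0 _.
have nAs : ~ A (seg x y s).
  move=> /((open_edistP _).1 oA)[e e0 Ae].
  have ed : 0 < e / (edist x y + 1) by rewrite divr_gt0// ltr_wpDl.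
  have [t [t0 nAt] ts] := inf_adherent ed (conj nT lT).
  have st : s <= t := ge_inf lT (conj t0 nAt).
  apply: nAt; apply: Ae; rewrite edist_seg.
  rewrite distrC ger0_norm ?subr_ge0//.
  apply: (@le_lt_trans _ _ ((t - s) * (edist x y + 1))).
    by rewrite ler_wpM2l ?subr_ge0// lerDl.
  by rewrite -ltr_pdivlMr ?ltr_wpDl// ltrBlDl.
have {}s0 : 0 < s.
  rewrite lt_neqAle s0 andbT; apply/eqP => s00.
  by apply: nAs; rewrite -s00 seg0.
exists s; first by rewrite s0 (ge_inf lT T1).
apply/frontier_openP => //; split=> //; apply/closure_edistP => e e0.
pose h := Num.min s (e / (edist x y + 1)).
have h0 : 0 < h by rewrite lt_min s0 divr_gt0// ltr_wpDl.
exists (seg x y (s - h / 2)).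
  apply: sin; last by rewrite ltrBlDr ltrDl divr_gt0.
  have : h <= s by rewrite ge_min lexx.
  lra.
rewrite edist_seg opprB addrC subrK ger0_norm; last by rewrite ltW// divr_gt0.
have : h * (edist x y + 1) <= e.
  by rewrite -ler_pdivlMr ?ltr_wpDl// ge_min lexx orbT.
nra.
Qed.

(** A point [z'] of [A] near [z] replaces [z]; the error is absorbed by moving [x] to [x'] inside a
    ball contained in [A], so that the point of the segment does not change. *)
Lemma open_convex_seg A x z t : open A ->
  convex_set (A : set (convex_lmodType 'rV[R]_N)) ->
  A x -> closure A z -> 0 <= t < 1 -> A (seg x z t).
Proof.
move=> oA /convex_setP cA Ax /closure_edistP clz /andP[t0 t1].
have [e e0 xA] := (open_edistP A).1 oA x Ax.
have t1' : 0 < 1 - t by rewrite subr_gt0.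
have [|z' Az' zz'] := clz (e * (1 - t)); first by rewrite mulr_gt0.
pose x' := x + (t / (1 - t)) *: (z - z').
have Ax' : A x'.
  apply: xA; rewrite /Defs.edist opprD addrA subrr add0r enormN enormZ.
  rewrite ger0_norm ?divr_ge0 ?(ltW t1')//.
  rewrite mulrAC ltr_pdivrMr//; apply: le_lt_trans zz'.
  by rewrite ler_piMl ?enorm_ge0// ltW.
have -> : seg x z t = seg x' z' t.
  rewrite !segE /x' scalerDr scalerA mulrC divfK ?gt_eqF//.
  by rewrite -addrA -scalerDr subrK.
by apply: cA => //; rewrite t0 ltW.
Qed.

(** The limit t -> 1 in elementary form: it carries an inequality from an open convex set to its
    closure, along segments from a point of the set. *)
Lemma nonpos_extend (a b : R) :
  (forall t, 0 < t < 1 -> a + t * b <= 0) -> a + b <= 0.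
Proof.
move=> h; rewrite leNgt; apply/negP => ab.
pose d := (a + b) / (2 * (`|b| + (a + b))).
have bn := normr_ge0 b; have bb := ler_norm b.
have D0 : 0 < 2 * (`|b| + (a + b)) by lra.
have d0 : 0 < d by rewrite divr_gt0.
have d1 : d < 1 by rewrite ltr_pdivrMr//; lra.
have /h : 0 < 1 - d < 1 by lra.
have : d * (2 * (`|b| + (a + b))) = a + b by rewrite divfK// gt_eqF.
nra.
Qed.

Lemma closed_bounded_compact A : bounded_set A -> compact (closure A).
Proof.
move=> /bounded_enormP[M M0 AM]; apply: bounded_closed_compact; last first.
  exact: closed_closure.
apply/bounded_enormP; exists (M + 1) => [|x /closure_edistP/(_ 1 ltr01)[y Ay]].
  by rewrite ltr_wpDl// ltW.
move=> xy; have := enormD (x - y) y; rewrite subrK => h.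
apply: le_trans h _; rewrite addrC lerD ?AM//.
exact: ltW.
Qed.

(* The affine function is the one vanishing on the hyperplane through the point
   of [closure A] nearest to [z]. *)
Lemma separating_affine A x z : open A -> bounded_set A ->
  convex_set (A : set (convex_lmodType 'rV[R]_N)) -> A x -> ~ closure A z ->
  exists v b, [/\ enorm v <= 1, 0 < dot v z + b &
    forall y, closure A y -> dot v y + b <= 0].
Proof.
move=> oA bA cA Ax nz.
have cz : continuous (edist z).
  apply: (@elipschitz_continuous _ _ 1) => u u'; rewrite mul1r ler_norml.
  have := edist_triangle u z u'; have := edist_triangle u' z u.
  by rewrite (edistC u' u); lra.
have [||p /set_mem clp pmin] :=
  @EVT_min_rV _ _ (edist z) (closure A) _ (closed_bounded_compact bA).
- by exists x; exact: subset_closure.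
- by apply: continuous_subspaceT => y; exact: cz.
pose v := z - p.
have v0 : v != 0 by rewrite subr_eq0; apply: contra_notN nz => /eqP->.
have nv : 0 < enorm v by rewrite enorm_gt0.
have inA y : A y -> dot v (y - p) <= 0.
  move=> Ay; rewrite leNgt; apply/negP => vy.
  pose D := dot (y - p) (y - p).
  have D0 : 0 <= D by exact: dotxx_ge0.
  (* Moving from [p] towards [y] by the fraction [s] changes the squared distance to [z] by - 2 s
     v.(y - p) + s^2 D, negative for this [s]; but [p] is nearest to [z]. *)
  pose s := Num.min 1 (dot v (y - p) / (D + 1)).
  have s0 : 0 < s by rewrite lt_min ltr01 divr_gt0// ltr_wpDl.
  have s1 : s <= 1 by rewrite ge_min lexx.
  have sD : s * (D + 1) <= dot v (y - p).
    by rewrite -ler_pdivlMr ?ltr_wpDl// ge_min lexx orbT.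
  have Aps : A (seg y p (1 - s)).
    by apply: open_convex_seg => //; apply/andP; split; lra.
  have := pmin _ (mem_set (subset_closure Aps)).
  rewrite /Defs.edist -(ler_pXn2r (n := 2))// ?nnegrE ?enorm_ge0// !enormK.
  have -> : z - seg y p (1 - s) = v - s *: (y - p).
    by rewrite /v /seg; apply/rowP => i; rewrite !mxE; ring.
  rewrite -/v; clear -vy D0 s0 sD; move: s s0 sD => s s0 sD.
  move: vy D0 sD; rewrite /D; clear D; move: (y - p) (v) => q w vq D0 sD.
  rewrite !(dotBl, dotBr, dotZl, dotZr) (dotC q w); nra.
have clA y : closure A y -> dot v (y - p) <= 0.
  move=> cy; rewrite -[y - p](subrKA x) addrC dotDr.
  apply: nonpos_extend => t /andP[t0 t1].
  have /inA : A (seg x y t) by apply: open_convex_seg => //; rewrite ltW.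
  by rewrite /seg addrAC dotDr dotZr.
exists ((enorm v)^-1 *: v), (- (enorm v)^-1 * dot v p); split.
- by rewrite enormZ ger0_norm ?invr_ge0 ?enorm_ge0// mulVf// gt_eqF.
- rewrite dotZl mulNr -mulrBr -dotBr mulr_gt0 ?invr_gt0//.
  by rewrite dotxx_gt0.
- move=> y /clA; rewrite dotZl mulNr -mulrBr -dotBr => vy.
  by rewrite mulr_ge0_le0// invr_ge0 enorm_ge0.
Qed.

End ConvexGeometry.

(** * Directional derivatives and explicit smooth functions *)

Lemma is_derive_lineP (R : numFieldType) (V W : normedModType R) (f : V -> W)
    x v df :
  is_derive x v f df <->
  is_derive (0 : R) (1 : R) (fun h : R => f (h *: v + x)) df.
Proof.
have E : 'D_v f x = 'D_(1 : R) (fun h : R => f (h *: v + x)) 0.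
  rewrite /derive; set g1 := fun h => _; set g2 := fun h => h^-1 *: _.
  suff -> : g1 = g2 by []; apply/funext => h; rewrite /g1 /g2 /=.
  by rewrite addr0 scale0r add0r [_%:A]mulr1.
split=> -[fx <-].
  by apply: (DeriveDef (iffLR (derivable1P f x v) fx)).
by apply: (DeriveDef (iffRL (derivable1P f x v) fx)).
Qed.

Lemma is_derive_comp1 (R : realType) (V : normedModType R) (h : R -> R)
    (f : V -> R) x v df dh :
  is_derive x v f df -> is_derive (f x) 1 h dh ->
  is_derive x v (h \o f) (df * dh).
Proof.
move=> /is_derive_lineP fx hx; apply/is_derive_lineP.
rewrite -[X in is_derive _ _ X _]/(h \o (fun a : R => f (a *: v + x))).
by rewrite mulrC; apply: is_derive1_comp => //; rewrite scale0r add0r.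
Qed.

Section SmoothExpressions.
Context {R : realType} {N : nat}.
Implicit Types (f g : 'rV[R]_N -> R).

(* A class of everywhere smooth functions that is closed under partial
   derivatives by construction. *)
Inductive smooth_expr : ('rV[R]_N -> R) -> Prop :=
| smooth_cst c : smooth_expr (fun=> c)
| smooth_coord i : smooth_expr (fun x => x ord0 i)
| smooth_add f g : smooth_expr f -> smooth_expr g ->
    smooth_expr (fun x => f x + g x)
| smooth_mul f g : smooth_expr f -> smooth_expr g ->
    smooth_expr (fun x => f x * g x)
| smooth_exp f : smooth_expr f -> smooth_expr (fun x => expR (f x))
| smooth_ln f : (forall x, 0 < f x) -> smooth_expr f ->
    smooth_expr (fun x => ln (f x)).

Lemma smooth_expr_derive f v : smooth_expr f ->
  exists2 g, smooth_expr g & forall x, is_derive x v f (g x).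
Proof.
elim=> {f} [c|i|f g _ [f' sf' df] _ [g' sg' dg]
  |f g sf [f' sf' df] sg [g' sg' dg]|f sf [f' sf' df]|f f0 sf [f' sf' df]].
- exists (fun=> 0) => [|x]; [exact: smooth_cst|exact: is_derive_cst].
- exists (fun=> v ord0 i) => [|x]; first exact: smooth_cst.
  apply/is_derive_lineP.
  have -> : (fun h : R => (h *: v + x) ord0 i) =
      (v ord0 i \*: id) + cst (x ord0 i).
    by apply/funext => h; rewrite !mxE fctE /= mulrC.
  by apply: is_derive_eq; rewrite addr0 /GRing.scale/= mulr1.
- exists (fun x => f' x + g' x) => [|x]; first exact: smooth_add.
  exact: is_deriveD.
- exists (fun x => f x * g' x + g x * f' x) => [|x].
    by apply: smooth_add; apply: smooth_mul.
  exact: is_deriveM.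
- exists (fun x => f' x * expR (f x)) => [|x].
    by apply: smooth_mul => //; apply: smooth_exp.
  exact: is_derive_comp1.
(* The factor 1 / f is expressed by [expR] and [ln], so that the class needs no constructor for
   inverses. *)
- exists (fun x => f' x * expR (-1 * ln (f x))) => [|x].
    apply: smooth_mul => //; apply: smooth_exp; apply: smooth_mul.
      exact: smooth_cst.
    exact: smooth_ln.
  have -> : expR (-1 * ln (f x)) = (f x)^-1.
    by rewrite mulN1r expRN lnK// posrE.
  by apply: is_derive_comp1 => //; exact: is_derive1_ln.
Qed.

Lemma smooth_expr_continuous f : smooth_expr f -> continuous f.
Proof.
elim=> {f} [c|i|f g _ fc _ gc|f g _ fc _ gc|f _ fc|f f0 _ fc] x.
- exact: cst_continuous.
- by apply: (@elipschitz_continuous _ _ 1) => {}x y;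
    rewrite mul1r (le_trans _ (norm_coord_enorm _ i))// !mxE.
- exact: (continuousD (fc x) (gc x)).
- exact: (continuousM (fc x) (gc x)).
- by apply: continuous_comp; [exact: fc|exact: continuous_expR].
- by apply: continuous_comp; [exact: fc|exact: continuous_ln].
Qed.

Lemma smooth_expr_smooth f U : smooth_expr f -> smooth_on U f.
Proof.
move=> sf s; have sp : smooth_expr (partials s f).
  elim: s => [//|i s IH] /=.
  have [g sg dg] := smooth_expr_derive (basis_vec R i) IH.
  suff -> : 'D_(basis_vec R i) (partials s f) = g by [].
  by apply/funext => x; rewrite derive_val.
move=> x _; split=> [|i]; first exact: smooth_expr_continuous.
by have [g _ dg] := smooth_expr_derive (basis_vec R i) sp; exact: ex_derive.
Qed.

Lemma smooth_expr_sum n (F : 'I_n -> 'rV[R]_N -> R) :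
  (forall i, smooth_expr (F i)) -> smooth_expr (fun x => \sum_(i < n) F i x).
Proof.
elim: n F => [|n IH] F sF.
  rewrite (_ : (fun _ => _) = fun=> 0); first exact: smooth_cst.
  by apply/funext => x; rewrite big_ord0.
rewrite (_ : (fun _ => _) =
  fun x => \sum_(i < n) F (widen_ord (leqnSn n) i) x + F ord_max x).
  by apply: smooth_add => //; apply: IH.
by apply/funext => x; rewrite big_ord_recr.
Qed.

Lemma smooth_expr_affine (v : 'rV[R]_N) c : smooth_expr (fun x => dot v x + c).
Proof.
apply: smooth_add; last exact: smooth_cst.
apply: smooth_expr_sum => i; apply: smooth_mul; first exact: smooth_cst.
exact: smooth_coord.
Qed.

End SmoothExpressions.

(** * Functions with continuous partial derivatives: differentiability and chain rule *)

Lemma is_derive_epsP (R : realType) (f : R -> R) (x df : R) :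
  is_derive x (1 : R) f df <->
  forall e, 0 < e -> exists2 d, 0 < d & forall h, `|h| < d ->
    `|f (x + h) - f x - df * h| <= e * `|h|.
Proof.
have key h : h != 0 ->
    h^-1 *: ((f \o shift x) (h *: (1 : R)) - f x) = (f (x + h) - f x) / h.
  by move=> h0; rewrite /GRing.scale /= mulr1 (addrC h) mulrC.
have E h e : h != 0 -> (`|df - (f (x + h) - f x) / h| <= e) =
    (`|f (x + h) - f x - df * h| <= e * `|h|).
  move=> h0; rewrite -ler_pdivrMr ?normr_gt0// -normrV ?unitfE// -normrM.
  by rewrite [X in _ = (`|X| <= _)]mulrBl mulfK// [in RHS]distrC.
split=> [[/cvg_ex[l /= fl] D] e e0|h].
  have {D}dfl : df = l by rewrite -D; apply: cvg_lim.
  rewrite -dfl in fl.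
  have [d /= d0 fd] := (cvgrPdist_le _ _).1 fl e e0.
  exists d => // h hd; have [->|h0] := eqVneq h 0.
    by rewrite addr0 subrr mulr0 subrr normr0 mulr0.
  rewrite -E// -key//; apply: fd => //.
  by rewrite /ball_/= sub0r normrN.
have fl : h^-1 *: ((f \o shift x) (h *: (1 : R)) - f x) @[h --> 0^'] --> df.
  apply/cvgrPdist_le => e /h[d d0 fd].
  exists d => //= k; rewrite /ball_/= sub0r normrN => kd k0.
  rewrite -[k^-1 *: _]/(k^-1 *: ((f \o shift x) (k *: (1 : R)) - f x)).
  by rewrite key// E// fd.
by apply: DeriveDef; [apply/cvg_ex; exists df|exact: cvg_lim fl].
Qed.

(** The parameter runs over [0, 1], so [a] may be negative or zero. *)
Lemma MVT_line (R : realType) (V : normedModType R) (f : V -> R) (v y : V)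
    (a : R) :
  (forall s : R, 0 <= s <= 1 -> derivable f ((s * a) *: v + y) v) ->
  exists2 s : R, 0 <= s <= 1 &
    f (a *: v + y) - f y = a * 'D_v f ((s * a) *: v + y).
Proof.
move=> df; pose g (s : R) : R := f ((s * a) *: v + y).
have dg (s : R) : 0 <= s <= 1 ->
    is_derive s (1 : R) g (a * 'D_v f ((s * a) *: v + y)).
  move=> /df/derivableP/is_derive_lineP fs.
  pose k (t : R) : R := a * (t - s).
  have -> : g = (fun h : R => f (h *: v + ((s * a) *: v + y))) \o k.
    apply/funext => t; rewrite /g /k /= addrA -scalerDl.
    by congr (f (_ *: _ + _)); ring.
  have ks : is_derive s (1 : R) k a.
    have -> : k = a \*: (id - cst s) by apply/funext.
    by apply: is_derive_eq; rewrite subr0 /GRing.scale/= mulr1.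
  rewrite [a * _]mulrC; apply: (is_derive1_comp _ ks).
  by rewrite /k subrr mulr0.
have [||s s01] :=
  @MVT_segment _ g (fun s => a * 'D_v f ((s * a) *: v + y)) 0 1 ler01.
- move=> s; rewrite in_itv/= => /andP[s0 s1].
  by apply: dg; rewrite !ltW.
- apply: derivable_within_continuous => s; rewrite in_itv/= => s01.
  by have [] := dg s s01.
rewrite /g mul1r mul0r scale0r add0r subr0 mulr1 => fE.
by exists s => //; move: s01; rewrite in_itv.
Qed.

Section C1.
Context {R : realType} {N : nat}.
Implicit Types (f : 'rV[R]_N -> R) (U : set 'rV[R]_N) (x y u v : 'rV[R]_N).

Definition C1_on U f := forall x, U x -> forall i,
  derivable f x (basis_vec R i) /\
  {for x, continuous ('D_(basis_vec R i) f)}.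

Lemma enorm_le_coord u v :
  (forall i, `|u ord0 i| <= `|v ord0 i|) -> enorm u <= enorm v.
Proof.
move=> uv; rewrite -(ler_pXn2r (n := 2))// ?nnegrE ?enorm_ge0// !enormK.
apply: ler_sum => i _; rewrite -!expr2 -[leLHS]real_normK ?num_real//.
by rewrite -[leRHS]real_normK ?num_real// lerXn2r ?nnegrE.
Qed.

(** The points [x + first_coords j h] lead from [x] to [x + h], changing one coordinate at a
    time. *)
Definition first_coords (j : nat) u : 'rV[R]_N :=
  \row_i (if (i < j)%N then u ord0 i else 0).

(** On each edge of the path through the points [x + first_coords j h], the mean value theorem
    produces a partial derivative at a point near [x], which continuity compares with the one at
    [x]. The N edges share the error [e]. *)
Lemma C1_differentiable U f x : open U -> C1_on U f -> U x ->
  forall e, 0 < e -> exists2 d, 0 < d & forall h, enorm h < d ->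
    `|f (x + h) - f x - dot (grad f x) h| <= e * enorm h.
Proof.
move=> oU fU Ux e e0; pose e' := e / (N%:R + 1).
have e'0 : 0 < e' by rewrite divr_gt0// ltr_wpDl.
have : \forall z \near nbhs x, U z /\
    forall i, `|'D_(basis_vec R i) f x - 'D_(basis_vec R i) f z| < e'.
  apply: (@filterI _ (nbhs x) (nbhs_filter x)).
    exact: open_nbhs_nbhs.
  apply: (@filter_forall _ _ _ (nbhs x) (nbhs_filter x)) => i.
  apply/nbhs_edistP; apply: (continuous_edistP _ _).1 e'0.
  by have [_] := fU _ Ux i.
move=> /nbhs_edistP[d d0 xd]; exists d => // h hd.
have key j : (j <= N)%N -> `|f (x + first_coords j h) - f x -
    dot (grad f x) (first_coords j h)| <= j%:R * (e' * enorm h).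
  elim: j => [_|j IH jN].
    have -> : first_coords 0 h = 0 by apply/rowP => i; rewrite !mxE.
    by rewrite addr0 subrr dot0r subr0 normr0 mul0r.
  pose i := Ordinal jN; pose v := basis_vec R i.
  have hE : first_coords j.+1 h = h ord0 i *: v + first_coords j h.
    apply/rowP => k; rewrite !mxE eqxx /= ltnS leq_eqVlt -val_eqE /=.
    have [kj|kj] := eqVneq (k : nat) j.
      have -> : k = i by exact: val_inj.
      by rewrite /= ltnn mulr1 addr0.
    by rewrite mulr0 add0r.
  have near_x s : 0 <= s <= 1 ->
      edist x ((s * h ord0 i) *: v + (x + first_coords j h)) < d.
    move=> /andP[s0 s1]; apply: le_lt_trans hd.
    rewrite edistC /Defs.edist addrCA addrAC subrr add0r.
    apply: enorm_le_coord => k; rewrite !mxE eqxx /= -val_eqE /=.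
    have [kj|kj] := eqVneq (k : nat) j.
      have -> : k = i by exact: val_inj.
      rewrite /= ltnn addr0 mulr1 normrM ger0_norm//.
      by rewrite ler_piMl.
    by rewrite mulr0 add0r; case: ifP => // _; rewrite normr0.
  have [|s s01 fE] := @MVT_line R _ f v (x + first_coords j h) (h ord0 i).
    by move=> s /near_x/xd[/fU/(_ i)[]].
  have [_ /(_ i)] := xd _ (near_x _ s01).
  set z := (s * _) *: _ + _ in fE * => Dz.
  have -> : f (x + first_coords j.+1 h) - f x -
      dot (grad f x) (first_coords j.+1 h) =
      (f (x + first_coords j h) - f x - dot (grad f x) (first_coords j h)) +
      h ord0 i * ('D_v f z - 'D_v f x).
    rewrite mulrBr -fE hE dotDr dotZr addrCA.
    have -> : dot (grad f x) v = 'D_v f x.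
      rewrite /dot (bigD1 i)//= big1 => [|k ki]; rewrite !mxE eqxx /=.
        by rewrite eqxx mulr1 addr0.
      by rewrite (negbTE ki) mulr0.
    ring.
  rewrite -natr1 mulrDl mul1r (le_trans (ler_normD _ _))// lerD ?IH 1?ltnW//.
  rewrite normrM mulrC ler_pM// ?norm_coord_enorm//.
  by rewrite distrC ltW.
have := key N (leqnn N).
have -> : first_coords N h = h by apply/rowP => i; rewrite mxE ltn_ord.
move=> /le_trans; apply; rewrite mulrA ler_wpM2r ?enorm_ge0//.
by rewrite /e' mulrCA ler_piMr ?(ltW e0)// ler_pdivrMr ?ltr_wpDl// mul1r lerDl.
Qed.

(* The chain rule is only needed along parabolas. *)
Lemma is_derive_parabola U f y v u t : open U -> C1_on U f ->
  U (y + t *: v + t ^+ 2 *: u) ->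
  is_derive t (1 : R) (fun s => f (y + s *: v + s ^+ 2 *: u))
    (dot (grad f (y + t *: v + t ^+ 2 *: u)) (v + (2 * t) *: u)).
Proof.
move=> oU fU; set x := y + _ + _ => Ux; apply/is_derive_epsP => e e0.
(* For |h| <= 1 the displacement [w] along the parabola has norm at most C |h|; [D] below bounds the
   effect of the part h^2 u of [w], which is quadratic in h. *)
pose C := enorm v + (2 * `|t| + 1) * enorm u + 1.
have t0 := normr_ge0 t; have u0 := enorm_ge0 u; have v0 := enorm_ge0 v.
have C0 : 0 < C by rewrite /C; nra.
have g0 := enorm_ge0 (grad f x); have d20 : 0 < e / 2 by rewrite divr_gt0.
have [d d0 fd] := C1_differentiable oU fU Ux (divr_gt0 d20 C0).
pose D := enorm (grad f x) * enorm u + 1.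
have D0 : 0 < D by rewrite /D; nra.
exists (Num.min 1 (Num.min (d / C) (e / 2 / D))).
  by rewrite !lt_min ltr01 !divr_gt0.
move=> h; rewrite !lt_min => /and3P[h1 hd hD].
rewrite ltr_pdivlMr// in hd; rewrite ltr_pdivlMr// in hD.
have h0 := normr_ge0 h.
pose w := h *: (v + (2 * t) *: u) + h ^+ 2 *: u.
have -> : y + (t + h) *: v + (t + h) ^+ 2 *: u = x + w.
  by apply/rowP => i; rewrite /x /w !mxE; ring.
have wC : enorm w <= C * `|h|.
  rewrite /w; apply: le_trans (enormD _ _) _; rewrite !enormZ normrX.
  rewrite expr2 -mulrA -mulrDr mulrC ler_wpM2r//.
  have := enormD v ((2 * t) *: u).
  rewrite enormZ normrM (ger0_norm (ler0n _ 2)) /C => ?; nra.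
have /fd : enorm w < d by apply: le_lt_trans wC _; rewrite mulrC.
set A := f _ - f x => Aw.
have -> : A - dot (grad f x) (v + (2 * t) *: u) * h =
    (A - dot (grad f x) w) + h ^+ 2 * dot (grad f x) u.
  by rewrite /w !(dotDr, dotZr); ring.
apply: le_trans (ler_normD _ _) _.
have -> : e * `|h| = e / 2 / C * (C * `|h|) + e / 2 * `|h|.
  by rewrite mulrA divfK ?gt_eqF// -mulrDl -splitr.
apply: lerD.
  by apply: le_trans Aw _; rewrite ler_wpM2l// !divr_ge0// ltW.
rewrite normrM normrX.
have := norm_dot_le (grad f x) u; rewrite /D in hD * => gu.
rewrite expr2 -[leLHS]mulrA [leLHS]mulrC ler_wpM2r//; nra.
Qed.

Lemma C1_is_derive U f x v : open U -> C1_on U f -> U x ->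
  is_derive x v f (dot (grad f x) v).
Proof.
move=> oU fU Ux; apply/is_derive_lineP.
have := @is_derive_parabola U f x v 0 0 oU fU.
rewrite !scaler0 !scale0r !addr0 => /(_ Ux); congr is_derive.
by apply/funext => s; rewrite scaler0 addr0 addrC.
Qed.

Lemma smooth_on_C1 U f : smooth_on U f -> C1_on U f.
Proof.
move=> sf x Ux i; split; first by have [_ ] := sf [::] x Ux; exact.
by have [] := sf [:: i] x Ux.
Qed.

Lemma smooth_on_C1_partial U f i :
  smooth_on U f -> C1_on U ('D_(basis_vec R i) f).
Proof.
move=> sf x Ux j; split; first by have [_ ] := sf [:: i] x Ux; exact.
by have [] := sf [:: j; i] x Ux.
Qed.

End C1.

(** * Principal curvatures through local defining functions *)

Section OneSided.
Context {R : realType}.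
Implicit Types (g : R -> R).

Lemma neg_after g d : is_derive (0 : R) (1 : R) g d -> d < 0 -> g 0 <= 0 ->
  exists2 r, 0 < r & forall t, 0 < t < r -> g t < 0.
Proof.
move=> /is_derive_epsP dg d0 g0.
have [|r r0 gr] := dg (- d / 2); first by rewrite divr_gt0// oppr_gt0.
exists r => // t /andP[t0 tr]; have := gr t.
rewrite (gtr0_norm t0) => /(_ tr); rewrite add0r ler_norml => /andP[_].
nra.
Qed.

(** Just after 0 the first derivative is negative by [neg_after], and the mean value theorem passes
    this on to [g]. *)
Lemma neg_after2 g g' r d : 0 < r ->
  (forall t, `|t| < r -> is_derive t (1 : R) g (g' t)) ->
  is_derive (0 : R) (1 : R) g' d -> d < 0 -> g' 0 <= 0 -> g 0 <= 0 ->
  exists2 r', 0 < r' & forall t, 0 < t < r' -> g t < 0.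
Proof.
move=> r0 dg dg' d0 g'0 g0; have [s s0 g's] := neg_after dg' d0 g'0.
exists (Num.min r s); first by rewrite lt_min r0.
move=> t /andP[t0]; rewrite lt_min => /andP[tr ts].
have dgt z : 0 <= z <= t -> is_derive z 1 g (g' z).
  by move=> /andP[z0 zt]; apply: dg; rewrite ger0_norm// (le_lt_trans zt).
have [||c] := @MVT _ g g' 0 t t0.
- by move=> z; rewrite in_itv/= => /andP[z0 zt]; apply: dgt; rewrite !ltW.
- apply: derivable_within_continuous => z; rewrite in_itv/= => z0t.
  by have [] := dgt z z0t.
rewrite in_itv/= => /andP[c0 ct]; have := g's c; rewrite c0 (lt_trans ct)//.
by move=> /(_ isT) ? ; nra.
Qed.

End OneSided.

Section Curvature.
Context {R : realType} {N : nat}.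
Implicit Types (Omega U : set 'rV[R]_N) (rho : 'rV[R]_N -> R).
Implicit Types (x y u v : 'rV[R]_N).

Lemma local_defining_le0 Omega U rho y :
  local_defining Omega y U rho -> closure Omega y -> rho y <= 0.
Proof.
move=> [oU Uy srho _ OE] /closure_edistP cly; rewrite leNgt; apply/negP => ry.
have [d1 d10 Ud] := (open_edistP U).1 oU y Uy.
have [d2 d20 rd] := (continuous_edistP _ _).1 (srho [::] y Uy).1 _ ry.
have [|z Oz] := cly (Num.min d1 d2); first by rewrite lt_min d10.
rewrite lt_min => /andP[yz1 yz2].
have /(congr1 (@^~ z)) := OE; rewrite propeqE /= => -[+ _].
move=> /(_ (conj Oz (Ud _ yz1)))[_ rz].
have := rd _ yz2; rewrite /= ltr_norml => /andP[_]; lra.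
Qed.

(** Along the parabola, [rho] starts at a value at most 0, with first derivative grad.v and second
    derivative Hess(v, v) + 2 grad.u. The two cases of the hypothesis make it negative right after
    the start. *)
Lemma parabola_inside Omega U rho y v u :
  local_defining Omega y U rho -> closure Omega y ->
  (dot (grad rho y) v < 0 \/ (dot (grad rho y) v = 0 /\
    \sum_i dot (grad ('D_(basis_vec R i) rho) y) v * v ord0 i
      + 2 * dot (grad rho y) u < 0)) ->
  exists2 r, 0 < r & forall t, 0 < t < r -> Omega (y + t *: v + t ^+ 2 *: u).
Proof.
move=> ld cly H; have [oU Uy srho _ OE] := ld.
have rC1 := smooth_on_C1 srho.
have pU : exists2 r, 0 < r & forall t, `|t| < r -> U (y + t *: v + t ^+ 2 *: u).
  have [d d0 Ud] := (open_edistP U).1 oU y Uy.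
  have vu : 0 < enorm v + enorm u + 1.
    by rewrite ltr_wpDl// addr_ge0 ?enorm_ge0.
  exists (Num.min 1 (d / (enorm v + enorm u + 1))).
    by rewrite lt_min ltr01 divr_gt0.
  move=> t; rewrite lt_min ltr_pdivlMr// => /andP[t1 td]; apply: Ud.
  rewrite /Defs.edist -addrA opprD addrA subrr add0r enormN.
  apply: le_lt_trans td; apply: le_trans (enormD _ _) _.
  rewrite !enormZ normrX expr2 -mulrA -mulrDr ler_wpM2l//.
  have := enorm_ge0 v; have := enorm_ge0 u; have := normr_ge0 t; nra.
have [r r0 {}pU] := pU.
pose g t := rho (y + t *: v + t ^+ 2 *: u).
have dg t : `|t| < r -> is_derive t (1 : R) g
    (dot (grad rho (y + t *: v + t ^+ 2 *: u)) (v + (2 * t) *: u)).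
  by move=> /pU; apply: is_derive_parabola.
have y0 : y + 0 *: v + 0 ^+ 2 *: u = y by rewrite expr0n/= !scale0r !addr0.
have g0 : g 0 <= 0 by rewrite /g y0; exact: local_defining_le0 ld cly.
suff [r' r'0 gneg] : exists2 r', 0 < r' & forall t, 0 < t < r' -> g t < 0.
  exists (Num.min r r'); first by rewrite lt_min r0.
  move=> t; rewrite lt_min => /and3P[t0 tr tr'].
  have Ut : U (y + t *: v + t ^+ 2 *: u) by apply: pU; rewrite gtr0_norm.
  have /(congr1 (@^~ (y + t *: v + t ^+ 2 *: u))) := OE.
  rewrite propeqE /= => -[_]; case=> //; split=> //.
  by apply: gneg; rewrite t0.
have {H}[dneg|[dzero hess]] := H.
  apply: (neg_after (dg 0 _)) => //; first by rewrite normr0.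
  by rewrite y0 mulr0 scale0r addr0.
apply: (neg_after2 r0 dg _ hess) => //; last first.
  by rewrite y0 mulr0 scale0r addr0 dzero.
(* The derivative of [g] is a sum of products; differentiating the factors [q i] at 0 gives the
   Hessian, differentiating the others gives 2 grad.u. *)
pose q i s := 'D_(basis_vec R i) rho (y + s *: v + s ^+ 2 *: u).
have -> :
  (fun t => dot (grad rho (y + t *: v + t ^+ 2 *: u)) (v + (2 * t) *: u))
    = \sum_i (q i * (cst (v ord0 i) + (2 * u ord0 i) \*: id)).
  apply/funext => t; rewrite fct_sumE; apply: eq_bigr => i _.
  rewrite !mxE /q !fctE /= -[_ *: t]/(2 * u ord0 i * t); ring.
have dq i : is_derive (0 : R) (1 : R) (q i)
    (dot (grad ('D_(basis_vec R i) rho) y) v).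
  have := @is_derive_parabola _ _ U ('D_(basis_vec R i) rho) y v u 0 oU.
  rewrite y0 mulr0 scale0r addr0; apply => //.
  exact: smooth_on_C1_partial.
apply: (@is_derive_eq _ _ _ _ _ _ _ _ (is_derive_sum _)).
rewrite mulr_sumr -big_split; apply: eq_bigr => i _ /=.
by rewrite /q y0 !fctE /GRing.scale/= !mxE; ring.
Qed.

(* The sum is the Hessian of [rho] at [y], evaluated at [(v, v)]. *)
Lemma normal_field_derive U rho y v : open U -> U y -> smooth_on U rho ->
  grad rho y != 0 -> dot (grad rho y) v = 0 ->
  dot ('D_v (normal_field rho) y) v =
    (enorm (grad rho y))^-1 *
    \sum_i dot (grad ('D_(basis_vec R i) rho) y) v * v ord0 i.
Proof.
move=> oU Uy srho g0 tang.
pose q i x := 'D_(basis_vec R i) rho x.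
have dq i : is_derive y v (q i) (dot (grad (q i) y) v).
  by apply: (C1_is_derive v oU) => //; exact: smooth_on_C1_partial.
(* Existence of [a] is enough: its contribution to the result is a multiple of grad.v, which is 0
   for tangent [v]. *)
have [a da] : exists a, is_derive y v (fun x => (enorm (grad rho x))^-1) a.
  have dS : derivable (fun x => dot (grad rho x) (grad rho x)) y v.
    have -> : (fun x => dot (grad rho x) (grad rho x)) = \sum_i (q i * q i).
      apply/funext => x; rewrite fct_sumE; apply: eq_bigr => i _.
      by rewrite !mxE.
    have h i : is_derive y v (q i * q i) _ := is_deriveM (dq i) (dq i).
    by have [] := is_derive_sum h.
  have S0 : 0 < dot (grad rho y) (grad rho y) by rewrite dotxx_gt0.
  have [dn _] := is_derive_comp1 (derivableP dS) (is_derive1_sqrt S0).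
  have : derivable (fun x => (enorm (grad rho x))^-1) y v.
    by apply: derivableV dn; rewrite gt_eqF// enorm_gt0.
  by move=> /derivableP; eexists; eassumption.
have dn i : is_derive y v (fun x => normal_field rho x ord0 i)
    ((enorm (grad rho y))^-1 * dot (grad (q i) y) v + q i y * a).
  have -> : (fun x => normal_field rho x ord0 i) =
      (fun x => (enorm (grad rho x))^-1) * q i.
    by apply/funext => x; rewrite !mxE.
  exact: is_deriveM.
have dN : derivable (normal_field rho) y v.
  by apply/derivable_mxP => i j; rewrite ord1; have [] := dn j.
rewrite derive_mx// mulr_sumr.
have -> : dot (\matrix_(i, j) 'D_v (fun t => normal_field rho t i j) y) v =
    \sum_i ((enorm (grad rho y))^-1 * (dot (grad (q i) y) v * v ord0 i)
            + a * (grad rho y ord0 i * v ord0 i)).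
  apply: eq_bigr => i _; rewrite !mxE; have [_ ->] := dn i.
  by rewrite /q; ring.
have {}tang : \sum_i grad rho y ord0 i * v ord0 i = 0 by [].
by rewrite big_split /= -[X in _ + X]mulr_sumr tang mulr0 addr0.
Qed.

(* With [u = grad rho y], the parabola [y + t v - s t^2 u] enters [Omega] as
   soon as [2 s |u|^2] exceeds the Hessian of [rho] at [(v, v)]; the order [t^2] of
   the hypothesis along it then bounds [s] from below. *)
Lemma principal_curvature_ge Omega y G m kappa : 0 < m ->
  (forall x, Omega x -> dot G (x - y) + m * dot (x - y) (x - y) <= 0) ->
  closure Omega y -> principal_curvature Omega y kappa ->
  2 * m <= kappa * enorm G.
Proof.
move=> m0 supp cly [U [rho [ld [v [v0 tang weing]]]]].
have [oU Uy srho /(_ _ Uy) gn0 _] := ld.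
set u := grad rho y in tang gn0.
have u0 : 0 < dot u u by rewrite dotxx_gt0.
(* Every direction entering [Omega] has nonpositive product with [G]; this will force [G] to be a
   nonnegative multiple of the normal [u]. *)
have first_order d : dot u d < 0 -> dot G d <= 0.
  move=> ud; have [r r0 Or] := parabola_inside (u := 0) ld cly (or_introl ud).
  have r20 : 0 < r / 2 < r by lra.
  have /supp := Or _ r20; rewrite scaler0 addr0 addrAC subrr add0r dotZr.
  have := dotxx_ge0 ((r / 2) *: d); move: r20 => /andP[r2 _]; nra.
pose mu := dot G u / dot u u; pose w := G - mu *: u.
have uw : dot u w = 0.
  by rewrite /w dotBr dotZr /mu divfK ?gt_eqF// (dotC G) subrr.
have mu0 : 0 <= mu.
  have /first_order : dot u (- u) < 0 by rewrite dotNr oppr_lt0.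
  by rewrite dotNr oppr_le0 => ?; rewrite divr_ge0// ltW.
have Gw : G = mu *: u + w by rewrite /w addrC subrK.
clearbody w mu.
(* Otherwise w - e u would enter [Omega], while its product with [G] is |w|^2 - e mu |u|^2, positive
   for small [e]. *)
have w0 : w = 0.
  apply/eqP; rewrite -dotxx_eq0 eq_le dotxx_ge0 andbT leNgt; apply/negP => ww.
  pose e := dot w w / (2 * (mu * dot u u + 1)).
  have D0 : 0 < mu * dot u u + 1 by nra.
  have e0 : 0 < e by rewrite divr_gt0// mulr_gt0.
  have eE : 2 * (e * (mu * dot u u + 1)) = dot w w.
    by rewrite /e; field; rewrite gt_eqF.
  have /first_order : dot u (w - e *: u) < 0.
    by rewrite dotBr dotZr uw sub0r oppr_lt0 mulr_gt0.
  rewrite Gw dotDl !dotBr !dotZl !dotZr uw (dotC w u) uw; nra.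
rewrite w0 addr0 in Gw.
set hess := \sum_i dot (grad ('D_(basis_vec R i) rho) y) v * v ord0 i.
have hessE : kappa * dot v v * enorm u = hess.
  have := normal_field_derive oU Uy srho gn0 tang.
  rewrite weing dotZl -/u -/hess => ->.
  by rewrite mulrAC mulVf ?mul1r// gt_eqF// enorm_gt0.
have second s : hess < 2 * s * dot u u -> m * dot v v <= s * mu * dot u u.
  move=> hs; have [|r r0 Or] := parabola_inside (v := v) (u := - s *: u) ld cly.
    by right; split => //; rewrite -/hess -/u dotZr; lra.
  have r20 : 0 < r / 2 < r by lra.
  have yE (a b : 'rV[R]_N) : y + a + b - y = a + b.
    by rewrite -(addrA y) [y + _]addrC addrK.
  have /supp := Or _ r20; rewrite yE.
  move: r20 => /andP[]; move: (r / 2) => t t0 _.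
  rewrite Gw !dotDl !dotDr !dotZl !dotZr (dotC v u) tang => h.
  have : t ^+ 2 * (m * dot v v) <= t ^+ 2 * (s * mu * dot u u).
    have : 0 <= m * ((t ^+ 2 * s) ^+ 2 * dot u u).
      by rewrite mulr_ge0 ?(ltW m0)// mulr_ge0 ?sqr_ge0// dotxx_ge0.
    lra.
  by rewrite ler_pM2l// exprn_gt0.
have v00 : 0 < dot v v by rewrite dotxx_gt0.
have key : 2 * (m * dot v v) <= mu * hess.
  apply/ler_addgt0Pr => e e0.
  pose s := (hess + e / (mu + 1)) / (2 * dot u u).
  have sE : 2 * s * dot u u = hess + e / (mu + 1).
    by rewrite /s; field; rewrite !gt_eqF// ltr_wpDl.
  have /second : hess < 2 * s * dot u u.
    by rewrite sE ltrDl divr_gt0// ltr_wpDl.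
  have : mu * (e / (mu + 1)) <= e.
    by rewrite mulrCA ler_piMr ?(ltW e0)// ler_pdivrMr ?ltr_wpDl// mul1r lerDl.
  have : mu * (2 * s * dot u u) = mu * hess + mu * (e / (mu + 1)).
    by rewrite sE mulrDr.
  lra.
rewrite Gw enormZ (ger0_norm mu0).
rewrite -(ler_pM2r v00) (_ : kappa * _ * _ = mu * hess).
  by rewrite -mulrA.
by rewrite -hessE; ring.
Qed.

End Curvature.

(** * Strongly convex functions and smooth approximation of maxima *)

Section StronglyConvex.
Context {R : realType} {N : nat}.
Implicit Types (f g : 'rV[R]_N -> R) (F G : 'rV[R]_N -> 'rV[R]_N).
Implicit Types (x y : 'rV[R]_N) (L M m : R).

(** The modulus [m] depends on the ball of radius [M]: with slopes bounded by [L] the growth is only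
    linear, which rules out a global quadratic term once N > 0. *)
Definition strong_subgradient f F L :=
  (forall y, enorm (F y) <= L) /\
  forall M, exists2 m, 0 < m & forall x y, enorm x <= M -> enorm y <= M ->
    f y + dot (F y) (x - y) + m * dot (x - y) (x - y) <= f x.

Lemma subgradient_le f F L x y : strong_subgradient f F L ->
  f y + dot (F y) (x - y) <= f x.
Proof.
move=> [_ /(_ (Num.max (enorm x) (enorm y)))[m m0 h]].
have := h x y; rewrite !le_max !lexx orbT => /(_ isT isT).
have := mulr_ge0 (ltW m0) (dotxx_ge0 (x - y)); lra.
Qed.

Lemma subgradient_elipschitz f F L : strong_subgradient f F L -> elipschitz L f.
Proof.
move=> fF; have [FL _] := fF.
have key x y : f x - f y <= L * edist x y.
  have := subgradient_le y x fF; have := norm_dot_le (F x) (y - x).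
  rewrite -[enorm (y - x)]/(edist y x) edistC ler_norml => /andP[h _].
  have := ler_wpM2r (enorm_ge0 (x - y)) (FL x).
  rewrite -[enorm (x - y)]/(edist x y); lra.
by move=> x y; rewrite ler_norml key andbT lerNl opprB edistC key.
Qed.

Lemma subgradientD f g F G L L' : strong_subgradient f F L ->
  strong_subgradient g G L' ->
  strong_subgradient (fun x => f x + g x) (fun x => F x + G x) (L + L').
Proof.
move=> fF gG; split=> [y|M].
  by apply: le_trans (enormD _ _) _; rewrite lerD ?fF.1 ?gG.1.
have [m m0 h] := fF.2 M; exists m => // x y xM yM.
have := h x y xM yM; have := subgradient_le x y gG; rewrite (dotDl (F y)); lra.
Qed.

(** The subgradient inequality tested at small steps in both directions of an axis bounds the
    partial derivative from both sides. *)
Lemma subgradient_grad f F L U x : strong_subgradient f F L -> smooth_on U f ->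
  U x -> grad f x = F x.
Proof.
move=> fF sf Ux; apply/rowP => i; rewrite mxE.
have [_ /(_ i) df] := sf [::] x Ux; rewrite /= in df.
apply/eqP; rewrite -subr_eq0 -normr_le0; apply/ler_addgt0Pr => e e0.
rewrite add0r.
have /is_derive_lineP/is_derive_epsP/(_ e e0)[d d0] := derivableP df.
have sub h : h * F x ord0 i <= f (h *: basis_vec R i + x) - f x.
  have := subgradient_le (h *: basis_vec R i + x) x fF.
  rewrite addrK dotZr.
  have -> : dot (F x) (basis_vec R i) = F x ord0 i.
    rewrite /dot (bigD1 i)//= big1 => [|k ki]; rewrite !mxE eqxx /=.
      by rewrite eqxx mulr1 addr0.
    by rewrite (negbTE ki) mulr0.
  lra.
move=> fd; have d20 : 0 < d / 2 by rewrite divr_gt0.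
have := fd (d / 2); have := fd (- (d / 2)); rewrite normrN (gtr0_norm d20).
rewrite !add0r scale0r add0r ltr_pdivrMr// ltr_pMr// ltr1n.
move=> /(_ isT) h1 /(_ isT) h2; have s1 := sub (d / 2).
have s2 := sub (- (d / 2)); rewrite ler_norml.
move: h1 h2; rewrite !ler_norml => /andP[_ h1] /andP[_ h2].
by apply/andP; split; rewrite -(ler_pM2r d20); lra.
Qed.

Definition japanese x : R := Num.sqrt (1 + dot x x).

Lemma japanese_gt0 x : 0 < japanese x.
Proof. by rewrite sqrtr_gt0 ltr_wpDr// dotxx_ge0. Qed.

Lemma japaneseK x : japanese x ^+ 2 = 1 + dot x x.
Proof. by rewrite sqr_sqrtr// addr_ge0// dotxx_ge0. Qed.

Lemma japanese_le x : japanese x <= 1 + enorm x.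
Proof.
rewrite -(ler_pXn2r (n := 2))// ?nnegrE ?(ltW (japanese_gt0 _))//.
  rewrite japaneseK sqrrD enormK; have := enorm_ge0 x; lra.
by rewrite addr_ge0// enorm_ge0.
Qed.

Lemma enorm_le_japanese x : enorm x <= japanese x.
Proof.
rewrite -(ler_pXn2r (n := 2))// ?nnegrE ?enorm_ge0 ?(ltW (japanese_gt0 _))//.
by rewrite japaneseK enormK; lra.
Qed.

Lemma japanese_smooth : smooth_expr japanese.
Proof.
have pos (x : 'rV[R]_N) : 0 < 1 + dot x x by rewrite ltr_wpDr// dotxx_ge0.
rewrite (_ : japanese = fun x => expR (2^-1 * ln (1 + dot x x))).
  apply/smooth_exp/smooth_mul/smooth_ln => //; first exact: smooth_cst.
  apply: smooth_add; first exact: smooth_cst.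
  by apply: smooth_expr_sum => i; apply: smooth_mul; exact: smooth_coord.
apply/funext => x; rewrite /japanese -powR12_sqrt ?(ltW (pos x))//.
by rewrite /powR gt_eqF.
Qed.

(* Cauchy-Schwarz for (1, x) and (1, y), with the Lagrange remainder bounded
   below by |x - y|^2. *)
Lemma japanese_subgradient_ineq x y :
  japanese y + dot ((japanese y)^-1 *: y) (x - y)
    + (2 * japanese x * japanese y ^+ 2)^-1 * dot (x - y) (x - y)
  <= japanese x.
Proof.
have X0 := japanese_gt0 x; have Y0 := japanese_gt0 y.
have XE := japaneseK x; have YE := japaneseK y.
have cs : dot x y ^+ 2 <= dot x x * dot y y.
  rewrite -!enormK -exprMn -[leLHS]real_normK ?num_real// lerXn2r ?nnegrE//.
    by rewrite mulr_ge0 ?enorm_ge0.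
  exact: norm_dot_le.
have D0 := dotxx_ge0 (x - y).
rewrite dotZl dotBr; move: D0; rewrite !(dotBl, dotBr) (dotC y x) => D0.
move: (dot x y) (dot x x) (dot y y) (japanese x) (japanese y) => s a b X Y
  in X0 Y0 XE YE cs D0 *.
set D := a - s - (s - b) in D0 *.
have P0 : 0 < X * Y by rewrite mulr_gt0.
have PT : D <= (X * Y) ^+ 2 - (1 + s) ^+ 2.
  by rewrite exprMn XE YE /D; lra.
have TP : 1 + s <= X * Y.
  rewrite leNgt; apply/negP => TP; nra.
(* The difference of squares in [PT] is factored, and the sum X Y + (1 + s) is bounded by 2 X Y. *)
have key : D <= (X * Y - (1 + s)) * (2 * (X * Y)) by nra.
have XY0 : 0 < 2 * X * Y ^+ 2 by rewrite !mulr_gt0 ?exprn_gt0.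
rewrite -(ler_pM2l XY0).
have -> : 2 * X * Y ^+ 2 * (Y + Y^-1 * (s - b) + (2 * X * Y ^+ 2)^-1 * D) =
   2 * X * Y * (Y ^+ 2 + (s - b)) + D.
  by field; rewrite !gt_eqF.
rewrite YE; nra.
Qed.

Lemma japanese_subgradient :
  strong_subgradient japanese (fun y => (japanese y)^-1 *: y) 1.
Proof.
split=> [y|M].
  rewrite enormZ ger0_norm ?invr_ge0 ?(ltW (japanese_gt0 y))//.
  by rewrite mulrC ler_pdivrMr ?japanese_gt0// mul1r enorm_le_japanese.
pose J := 1 + `|M|; have J0 : 0 < J by rewrite ltr_pwDl.
exists (2 * J * J ^+ 2)^-1; first by rewrite invr_gt0 !mulr_gt0 ?exprn_gt0.
have jJ x : enorm x <= M -> japanese x <= J.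
  move=> xM; rewrite (le_trans (japanese_le x))// lerD2l.
  by rewrite (le_trans xM)// ler_norm.
move=> x y /jJ xJ /jJ yJ; apply: le_trans (japanese_subgradient_ineq x y).
have X0 := japanese_gt0 x; have Y0 := japanese_gt0 y.
rewrite lerD2l ler_wpM2r ?dotxx_ge0// lef_pV2 ?posrE ?mulr_gt0 ?exprn_gt0//.
have XJ : 2 * japanese x <= 2 * J by lra.
have YJ : japanese y ^+ 2 <= J ^+ 2 by rewrite lerXn2r ?nnegrE// ltW.
by apply: ler_pM XJ YJ; rewrite ?sqr_ge0// mulr_ge0// ltW.
Qed.

Section LogSumExp.
Context (I : eqType) (s : seq I) (a : I -> 'rV[R]_N) (c : I -> R).
Context (lambda : R) (lambda0 : 0 < lambda) (s0 : s != [::]).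

Let ell i x := dot (a i) x + c i.
Let e i x := expR (lambda * ell i x).
Let S x := \sum_(i <- s) e i x.

(** With the mean instead of the sum, the value never exceeds the maximum of the affine functions;
    the price is to fall below it by at most [ln (size s)%:R / lambda]. *)
Definition log_mean_exp x : R :=
  lambda^-1 * ln ((size s)%:R^-1 *
    \sum_(i <- s) expR (lambda * (dot (a i) x + c i))).

Definition log_mean_exp_grad x : 'rV[R]_N :=
  \sum_(i <- s) (expR (lambda * (dot (a i) x + c i)) /
    \sum_(i <- s) expR (lambda * (dot (a i) x + c i))) *: a i.

Let S_gt0 x : 0 < S x.
Proof.
rewrite /S; case: s s0 => // i r _; rewrite big_cons ltr_pwDl ?expR_gt0//.
by apply: sumr_ge0 => j _; exact: expR_ge0.
Qed.

Let size_gt0 : 0 < (size s)%:R :> R.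
Proof. by rewrite ltr0n; case: s s0. Qed.

Lemma log_mean_expE x :
  log_mean_exp x = lambda^-1 * (ln (S x) - ln (size s)%:R).
Proof.
have Sx := S_gt0 x; rewrite /log_mean_exp -/(S x).
by rewrite lnM ?posrE ?invr_gt0// lnV ?posrE// [- _ + _]addrC.
Qed.

Lemma log_mean_exp_smooth : smooth_expr log_mean_exp.
Proof.
have sm (r : seq I) : smooth_expr (fun x => \sum_(i <- r) e i x).
  elim: r => [|i r IH].
    rewrite (_ : (fun _ => _) = fun=> 0); first exact: smooth_cst.
    by apply/funext => x; rewrite big_nil.
  rewrite (_ : (fun _ => _) = fun x => e i x + \sum_(i <- r) e i x).
    apply: smooth_add => //.
    apply/smooth_exp/smooth_mul; first exact: smooth_cst.
    exact: smooth_expr_affine.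
  by apply/funext => x; rewrite big_cons.
apply/smooth_mul/smooth_ln; first exact: smooth_cst.
  by move=> x; rewrite mulr_gt0 ?invr_gt0//; exact: S_gt0.
by apply: smooth_mul => //; exact: smooth_cst.
Qed.

Lemma log_mean_exp_le x B : (forall i, i \in s -> dot (a i) x + c i <= B) ->
  log_mean_exp x <= B.
Proof.
move=> h; rewrite log_mean_expE mulrC ler_pdivrMr//.
rewrite -ln_div ?posrE// -(expRK (B * lambda)).
rewrite ler_ln ?posrE ?expR_gt0 ?divr_gt0//.
rewrite ler_pdivrMr//.
rewrite /S; apply: (@le_trans _ _ (\sum_(i <- s) expR (B * lambda))).
  rewrite [leLHS]big_seq [leRHS]big_seq; apply: ler_sum => i si.
  rewrite ler_expR mulrC ler_pM2r//.
  exact: h.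
by rewrite big_const_seq count_predT iter_addr_0 mulr_natr.
Qed.

Lemma log_mean_exp_ge x i : i \in s ->
  dot (a i) x + c i - ln (size s)%:R / lambda <= log_mean_exp x.
Proof.
move=> si; rewrite log_mean_expE mulrBr [_^-1 * ln (size s)%:R]mulrC lerD2r.
rewrite -(ler_pM2l lambda0) mulrA divff ?gt_eqF// mul1r -[leLHS]expRK.
rewrite ler_ln ?posrE ?expR_gt0//.
rewrite /S (perm_big _ (perm_to_rem si)) big_cons lerDl.
by apply: sumr_ge0 => j _; exact: expR_ge0.
Qed.

Lemma log_mean_exp_grad_le L y :
  (forall i, i \in s -> enorm (a i) <= L) -> enorm (log_mean_exp_grad y) <= L.
Proof.
move=> aL; apply: (@le_trans _ _ (\sum_(i <- s) e i y / S y * enorm (a i))).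
  rewrite /log_mean_exp_grad -/(S y); have Sy := S_gt0 y.
  elim: (s) => [|i r IH].
    by rewrite !big_nil enorm0.
  rewrite !big_cons; apply: le_trans (enormD _ _) _; rewrite lerD//.
  by rewrite enormZ ger0_norm ?lexx// divr_ge0 ?expR_ge0// ltW.
apply: (@le_trans _ _ (\sum_(i <- s) e i y / S y * L)).
  rewrite [leLHS]big_seq [leRHS]big_seq; apply: ler_sum => i si.
  rewrite ler_wpM2l ?aL//.
  by rewrite divr_ge0 ?expR_ge0// ltW.
by rewrite -!mulr_suml -/(S y) divff ?mul1r// gt_eqF// S_gt0.
Qed.

(* Jensen's inequality for the weights [e i y / S y], from [1 + u <= expR u]. *)
Lemma log_mean_exp_subgradient x y :
  log_mean_exp y + dot (log_mean_exp_grad y) (x - y) <= log_mean_exp x.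
Proof.
pose p i := e i y / S y; pose u i := lambda * dot (a i) (x - y).
have Sy := S_gt0 y; have Sx := S_gt0 x.
have p1 : \sum_(i <- s) p i = 1 by rewrite -mulr_suml divff// gt_eqF.
pose m := \sum_(i <- s) p i * u i.
have mE : lambda * dot (log_mean_exp_grad y) (x - y) = m.
  rewrite dot_suml mulr_sumr; apply: eq_bigr => i _.
  by rewrite dotZl mulrCA.
have SxE : S x = S y * \sum_(i <- s) p i * expR (u i).
  rewrite mulr_sumr; apply: eq_bigr => i _.
  rewrite /p mulrA mulrCA divff ?gt_eqF// mulr1 -expRD; congr expR.
  by rewrite /u /ell dotBr; ring.
have : expR m <= \sum_(i <- s) p i * expR (u i).
  rewrite -[leLHS]mulr1 -ler_pdivlMl ?expR_gt0// -expRN mulr_sumr.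
  apply: (@le_trans _ _ (\sum_(i <- s) p i * (1 + (u i - m)))).
    under eq_bigr do rewrite mulrDr mulr1 mulrBr.
    by rewrite big_split sumrB /= -[X in _ - X]mulr_suml p1 mul1r subrr addr0.
  apply: ler_sum => i _; rewrite mulrCA ler_wpM2l//.
    by rewrite divr_ge0 ?expR_ge0// ltW.
  by rewrite -expRD [- m + _]addrC expR_ge1Dx.
move=> mle; rewrite -(ler_pM2l lambda0) mulrDr mE !log_mean_expE.
rewrite !mulrA divff ?gt_eqF// !mul1r addrAC lerD2r -ler_expR.
by rewrite expRD !lnK ?posrE// SxE ler_pM2l.
Qed.

End LogSumExp.

(* [log_mean_exp] is only convex; a small multiple of [japanese] makes the
   approximation strongly convex without spoiling the Lipschitz constant. *)
Lemma smooth_max_approx (I : eqType) (s : seq I) (a : I -> 'rV[R]_N)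
    (c : I -> R) L M eta : 0 < eta -> s != [::] ->
  (forall i, i \in s -> enorm (a i) <= L) ->
  exists f F, [/\ smooth_expr f, strong_subgradient f F (L + eta),
    forall x B, enorm x <= M ->
      (forall i, i \in s -> dot (a i) x + c i <= B) -> f x < B &
    forall x i, i \in s -> dot (a i) x + c i - eta <= f x].
Proof.
move=> eta0 s0 aL.
have n1 : 1 <= (size s)%:R :> R by rewrite ler1n; case: s s0 {aL}.
have l0 := ln_ge0 n1.
(* Makes the loss [ln (size s)%:R / lambda] at most eta / 2; the + 1 keeps [lambda] positive for a
   single function. *)
pose lambda := 2 * (ln (size s)%:R + 1) / eta.
have lambda0 : 0 < lambda by rewrite divr_gt0// mulr_gt0// ltr_wpDl.
(* [Q] exceeds [japanese] on the ball of radius [M], so the corrector eps (japanese - Q) is negative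
   there; everywhere it is above - eps Q = - eta / 2. *)
pose Q := 2 + `|M|; have Q0 : 0 < Q by rewrite ltr_pwDl.
pose eps := eta / (2 * Q).
have eps0 : 0 < eps by rewrite divr_gt0// mulr_gt0.
have epsQ : eps * Q = eta / 2 by rewrite /eps; field; rewrite gt_eqF.
have Q2 : 2 <= Q by rewrite lerDl.
have eps1 : eps <= eta by nra.
pose f x := log_mean_exp s a c lambda x + eps * (japanese x - Q).
exists f, (fun x => log_mean_exp_grad s a c lambda x
                    + eps *: ((japanese x)^-1 *: x)); split.
- apply: smooth_add; first exact: log_mean_exp_smooth.
  apply: smooth_mul; first exact: smooth_cst.
  apply: smooth_add; [exact: japanese_smooth|exact: smooth_cst].
- have [JL Jm] := japanese_subgradient; split=> [y|M'].
    apply: le_trans (enormD _ _) _; rewrite lerD ?log_mean_exp_grad_le//.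
    rewrite enormZ gtr0_norm//; have := JL y; nra.
  have [m m0 Jx] := Jm M'; exists (eps * m); first by rewrite mulr_gt0.
  move=> x y xM yM; have := Jx x y xM yM.
  have := log_mean_exp_subgradient a c lambda0 s0 x y.
  rewrite /f (dotDl (log_mean_exp_grad _ _ _ _ _)) (dotZl eps); nra.
- move=> x B xM /(log_mean_exp_le lambda0 s0) fB; rewrite /f.
  have : japanese x < Q.
    rewrite (le_lt_trans (japanese_le x))// /Q.
    have := ler_norm M; lra.
  nra.
- move=> x i si; rewrite /f.
  have := log_mean_exp_ge a c lambda0 s0 x si.
  have : ln (size s)%:R / lambda <= eta / 2.
    rewrite /lambda invf_div mulrA ler_pdivrMr ?mulr_gt0 ?ltr_wpDl//; nra.
  have := japanese_gt0 x; nra.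
Qed.

End StronglyConvex.

(** * Convex and concave barriers from the bounded slope condition *)

Section Barriers.
Context {R : realType} {N : nat}.
Implicit Types (Omega : set 'rV[R]_N) (phi : 'rV[R]_N -> R).
Implicit Types (x y a b : 'rV[R]_N).

Lemma ray_exit Omega x0 v : open Omega -> bounded_set Omega -> Omega x0 ->
  v != 0 -> exists2 t, 0 < t & frontier Omega (x0 + t *: v).
Proof.
move=> oO /bounded_enormP[M M0 OM] Ox0 v0.
have nv : 0 < enorm v by rewrite enorm_gt0.
pose T := (enorm x0 + M + 1) / enorm v.
have T0 : 0 < T by rewrite divr_gt0// ltr_wpDl// addr_ge0 ?enorm_ge0// ltW.
have [|t /andP[t0 _]] := @exit_point _ _ Omega x0 (x0 + T *: v) oO Ox0.
  move=> /OM; apply/negP; rewrite -ltNge.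
  have := enormD (x0 + T *: v) (- x0).
  rewrite addrAC subrr add0r enormN enormZ gtr0_norm// divfK ?gt_eqF//; lra.
rewrite /seg addrAC subrr add0r scalerA => ft.
by exists (t * T); first exact: mulr_gt0.
Qed.

Lemma closed_frontier Omega : closed (frontier Omega).
Proof.
rewrite /frontier setDE; apply: closedI; first exact: closed_closure.
by apply: open_closedC; exact: open_interior.
Qed.

Lemma compact_frontier Omega : bounded_set Omega -> compact (frontier Omega).
Proof.
move=> bO; apply: (subclosed_compact _ (closed_bounded_compact bO)).
  exact: (@closed_frontier Omega).
by move=> x [].
Qed.

Lemma const_mx1_neq0 : (0 < N)%N -> const_mx 1 != 0 :> 'rV[R]_N.
Proof.
move=> N0; apply/eqP => /rowP/(_ (Ordinal N0)); rewrite !mxE => /eqP.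
by rewrite oner_eq0.
Qed.

Lemma frontier_nonempty Omega x : (0 < N)%N -> open Omega ->
  bounded_set Omega -> Omega x -> frontier Omega !=set0.
Proof.
move=> N0 oO bO Ox.
have [s _ fs] := ray_exit oO bO Ox (const_mx1_neq0 N0).
by eexists; exact: fs.
Qed.

Lemma frontier_neq Omega x a : open Omega -> Omega x -> frontier Omega a ->
  a != x.
Proof.
by move=> oO Ox /(frontier_openP _ oO)[_ nOa]; apply: contra_notN nOa => /eqP->.
Qed.

Lemma bounded_slope_lipschitz Omega K phi x y :
  bounded_slope_condition Omega K phi -> frontier Omega x -> frontier Omega y ->
  `|phi x - phi y| <= K * edist x y.
Proof.
have key u v : bounded_slope_condition Omega K phi -> frontier Omega u ->
    frontier Omega v -> phi u - phi v <= K * edist u v.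
  move=> bsc fu fv; have [zm [zp [_ zpK /(_ _ fu)/andP[_ h]]]] := bsc v fv.
  have := dot_le_enorm zp (u - v); have := ler_wpM2r (enorm_ge0 (u - v)) zpK.
  rewrite /Defs.edist; lra.
move=> bsc fx fy; rewrite ler_norml key// andbT lerNl opprB edistC.
exact: key.
Qed.

(* Both slopes at [a] are tested at the second boundary point of the line
   through [a] and [x0]. *)
Lemma slopes_outward Omega phi x0 a zm zp : open Omega ->
  bounded_set Omega -> Omega x0 -> frontier Omega a ->
  (forall x, frontier Omega x ->
     phi a + dot zm (x - a) <= phi x <= phi a + dot zp (x - a)) ->
  0 <= dot (zm - zp) (a - x0).
Proof.
move=> oO bO Ox0 fa h.
have v0 : x0 - a != 0 by rewrite subr_eq0 eq_sym (frontier_neq oO Ox0 fa).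
have [t t0 /h] := ray_exit oO bO Ox0 v0.
have -> : x0 + t *: (x0 - a) - a = (1 + t) *: (x0 - a).
  by apply/rowP => i; rewrite !mxE; ring.
have -> : a - x0 = - (x0 - a) by rewrite opprB.
rewrite dotNr dotBl !dotZr => /andP[h1 h2].
have t1 : 0 < 1 + t by lra.
by rewrite oppr_ge0 -(pmulr_rle0 _ t1) mulrBr; lra.
Qed.

(** The affine functions touching [phi] at [a] differ at [z] by (zm - zp).(z - a), which is
    nonnegative because z - a is a positive multiple of a - x0. The two halves of a function
    separating [z] from [Omega] make the difference positive and only lower both functions on the
    boundary. The upper function enters with its sign changed. *)
Lemma contact_pair Omega K phi x0 a t : open Omega -> bounded_set Omega ->
  convex_set (Omega : set (convex_lmodType 'rV[R]_N)) -> Omega x0 ->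
  bounded_slope_condition Omega K phi -> 0 < t -> frontier Omega a ->
  exists zl cl zu cu,
    [/\ enorm zl <= K + 2^-1, enorm zu <= K + 2^-1,
      forall x, frontier Omega x ->
        dot zl x + cl <= phi x /\ dot zu x + cu <= - phi x &
      0 < (dot zl (seg x0 a (1 + t)) + cl) + (dot zu (seg x0 a (1 + t)) + cu)].
Proof.
move=> oO bO cO Ox0 bsc t0 fa; set z := seg x0 a (1 + t).
have [zm [zp [zmK zpK slopes]]] := bsc a fa.
have nz : ~ closure Omega z.
  (* Otherwise [a] would lie strictly between [x0] in [Omega] and a point of the closure, hence in
     [Omega]. *)
  move=> clz; have [_] := (frontier_openP a oO).1 fa; apply.
  have -> : a = seg x0 z (1 + t)^-1.
    by rewrite /seg /z /seg addrAC subrr add0r scalerA mulVf ?gt_eqF//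
      ?addr_gt0// scale1r addrC subrK.
  apply: open_convex_seg => //; rewrite invr_ge0 invf_lt1 ?addr_gt0//.
  by rewrite addr_ge0// ?ltW// ltrDl.
have [v [b [v1 vz vO]]] := separating_affine oO bO cO Ox0 nz.
exists (zm + 2^-1 *: v), (phi a - dot zm a + 2^-1 * b).
exists (- zp + 2^-1 *: v), (- phi a + dot zp a + 2^-1 * b).
have nv : enorm (2^-1 *: v) <= 2^-1.
  by rewrite enormZ ger0_norm ?invr_ge0// ler_piMr// invr_ge0.
split.
- by apply: le_trans (enormD _ _) _; rewrite lerD.
- by apply: le_trans (enormD _ _) _; rewrite enormN lerD.
- move=> x fx; have /andP[] := slopes x fx.
  have : dot v x + b <= 0 by apply: vO; have [] := fx.
  rewrite !(dotBr, dotDl, dotZl, dotNl); lra.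
- have : 0 <= dot (zm - zp) (z - a).
    have -> : z - a = t *: (a - x0).
      by apply/rowP => i; rewrite /z /seg !mxE; ring.
    rewrite dotZr mulr_ge0 ?(ltW t0)//.
    exact: slopes_outward oO bO Ox0 fa slopes.
  move: vz; clearbody z; rewrite !(dotBr, dotBl, dotDl, dotZl, dotNl); lra.
Qed.

Lemma seq_pos_lower_bound (I : eqType) (s : seq I) (f : I -> R) :
  (forall i, i \in s -> 0 < f i) ->
  exists2 m, 0 < m & forall i, i \in s -> m <= f i.
Proof.
elim: s => [_|i s IH fs]; first by exists 1.
have [j js|m m0 mf] := IH; first by rewrite fs// inE js orbT.
exists (Num.min (f i) m); first by rewrite lt_min m0 fs// inE eqxx.
move=> j; rewrite inE ge_min => /predU1P[->|/mf ->]; first by rewrite lexx.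
by rewrite orbT.
Qed.

(** The gap belonging to a contact point [a] is continuous in the boundary point [b] and positive at
    [b] = [a], so it keeps more than half its value nearby. A finite subcover gives a common
    positive lower bound [m], which survives the smoothing. *)
Lemma barriers Omega K phi x0 t : (0 < N)%N -> open Omega ->
  bounded_set Omega ->
  convex_set (Omega : set (convex_lmodType 'rV[R]_N)) -> Omega x0 ->
  bounded_slope_condition Omega K phi -> 0 < t ->
  exists gl Gl gu Gu,
    [/\ smooth_expr gl /\ smooth_expr gu,
      strong_subgradient gl Gl (K + 1) /\ strong_subgradient gu Gu (K + 1),
      forall x, frontier Omega x -> gl x < phi x /\ gu x < - phi x &
      forall a, frontier Omega a ->
        0 < gl (seg x0 a (1 + t)) + gu (seg x0 a (1 + t))].
Proof.
move=> N0 oO bO cO Ox0 bsc t0.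
have /choice[d dP] : forall a, exists d : ('rV[R]_N * R) * ('rV[R]_N * R),
    frontier Omega a ->
    [/\ enorm d.1.1 <= K + 2^-1, enorm d.2.1 <= K + 2^-1,
      forall x, frontier Omega x ->
        dot d.1.1 x + d.1.2 <= phi x /\ dot d.2.1 x + d.2.2 <= - phi x &
      0 < (dot d.1.1 (seg x0 a (1 + t)) + d.1.2) +
        (dot d.2.1 (seg x0 a (1 + t)) + d.2.2)].
  move=> a; have [fa|nfa] := pselect (frontier Omega a); last first.
    (* A dummy value: [dP] is applied only at boundary points. *)
    by exists ((0, 0), (0, 0)).
  have [zl [cl [zu [cu H]]]] := contact_pair oO bO cO Ox0 bsc t0 fa.
  by exists ((zl, cl), (zu, cu)).
pose gap a b := (dot (d a).1.1 (seg x0 b (1 + t)) + (d a).1.2) +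
        (dot (d a).2.1 (seg x0 b (1 + t)) + (d a).2.2).
pose V a := [set b | gap a a / 2 < gap a b].
have := compact_frontier bO; rewrite compact_cover.
move=> /(_ _ (frontier Omega) V)[a _|a fa|D DO cov].
- have gc : continuous (gap a).
    apply: (@elipschitz_continuous _ _
      ((enorm (d a).1.1 + enorm (d a).2.1) * (1 + t))) => x y.
    have -> : gap a x - gap a y =
        dot ((d a).1.1 + (d a).2.1) ((1 + t) *: (x - y)).
      rewrite /gap /seg !(dotDl, dotDr, dotZr, dotNr); ring.
    apply: le_trans (norm_dot_le _ _) _.
    rewrite enormZ gtr0_norm ?addr_gt0// mulrA ler_wpM2r ?enorm_ge0//.
    by rewrite ler_wpM2r ?enormD// addr_ge0// ltW.
  have -> : V a = gap a @^-1` [set r | gap a a / 2 < r] by [].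
  by apply: open_comp; [move=> x _; exact: gc|exact: open_gt].
- exists a => //; rewrite /V /=.
  by have [_ _ _] := dP _ fa; rewrite -/(gap a a) => ?; lra.
pose s : seq 'rV[R]_N := finmap.enum_fset D.
have sO a : a \in s -> frontier Omega a by move=> /DO /set_mem.
have covs b : frontier Omega b -> exists2 a, a \in s & gap a a / 2 < gap a b.
  by move=> /cov[a /= aD ab]; exists a.
have s0 : s != [::].
  have [b /covs[a]] := frontier_nonempty N0 oO bO Ox0.
  by case: (s).
have [m m0 mgap] := @seq_pos_lower_bound _ s (fun a => gap a a / 2) (fun a sa =>
  let: And4 _ _ _ h := dP a (sO a sa) in divr_gt0 h (ltr0Sn _ 1)).
have [M M0 OM] := (bounded_enormP _).1 (compact_bounded (compact_frontier bO)).
(* The bound 1/2 keeps the slopes below K + 1; the bound m / 2 pays for two smoothings, each losing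
   at most [eta]. *)
pose eta := Num.min (2^-1) (m / 2).
have eta0 : 0 < eta by rewrite lt_min invr_gt0 ltr0n divr_gt0.
have eta1 : eta <= 2^-1 by rewrite ge_min lexx.
have etam : eta <= m / 2 by rewrite ge_min lexx orbT.
have [|gl [Gl [sl subl lel gel]]] := @smooth_max_approx _ _ _ s
  (fun a => (d a).1.1) (fun a => (d a).1.2) (K + 2^-1) M _ eta0 s0.
  by move=> a /sO/dP[].
have [|gu [Gu [su subu leu geu]]] := @smooth_max_approx _ _ _ s
  (fun a => (d a).2.1) (fun a => (d a).2.2) (K + 2^-1) M _ eta0 s0.
  by move=> a /sO/dP[].
have weaken f F : strong_subgradient f F (K + 2^-1 + eta) ->
    strong_subgradient f F (K + 1).
  by move=> [FK ?]; split=> // y; rewrite (le_trans (FK y))//; lra.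
exists gl, Gl, gu, Gu; split=> //; first by split; exact: weaken.
- move=> x fx; have xM := OM _ fx; split.
    by apply: lel => // a /sO/dP[_ _ /(_ _ fx)[]].
  by apply: leu => // a /sO/dP[_ _ /(_ _ fx)[]].
- move=> b /covs[a sa ab]; have := gel (seg x0 b (1 + t)) a sa.
  have := geu (seg x0 b (1 + t)) a sa; have := mgap a sa.
  rewrite /= in ab *; rewrite /gap in ab *; lra.
Qed.

Definition mcshane (A : set 'rV[R]_N) K phi x : R :=
  inf [set phi y + K * edist x y | y in A].

Lemma mcshaneP (A : set 'rV[R]_N) K phi y0 : 0 <= K -> A y0 ->
  (forall x y, A x -> A y -> `|phi x - phi y| <= K * edist x y) ->
  elipschitz K (mcshane A K phi) /\ forall x, A x -> mcshane A K phi x = phi x.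
Proof.
move=> K0 Ay0 phiK.
have lb x : has_lbound [set phi y + K * edist x y | y in A].
  exists (phi y0 - K * edist x y0) => _ [y Ay <-].
  have := phiK _ _ Ay0 Ay; rewrite ler_norml => /andP[_].
  have := ler_wpM2l K0 (edist_triangle x y0 y); rewrite (edistC y0 x); lra.
have ne x : [set phi y + K * edist x y | y in A] !=set0.
  by exists (phi y0 + K * edist x y0), y0.
have key x z : mcshane A K phi x - mcshane A K phi z <= K * edist x z.
  rewrite lerBlDl -lerBlDr; apply: lb_le_inf => // _ [y Ay <-].
  have : mcshane A K phi x <= phi y + K * edist x y.
    by apply: ge_inf => //; exists y.
  have := ler_wpM2l K0 (edist_triangle z x y); lra.
split=> [x z|x Ax].
  by rewrite ler_norml key andbT lerNl opprB edistC key.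
apply/eqP; rewrite eq_le; apply/andP; split.
  by apply: ge_inf => //; exists x => //; rewrite edistxx mulr0 addr0.
apply: lb_le_inf => // _ [y Ay <-].
by have := phiK _ _ Ax Ay; rewrite ler_norml => /andP[_]; lra.
Qed.

End Barriers.

(** * Lebesgue measure: null boundaries of convex sets and shrinking dilations *)

Section TupleMeasure.
Context {R : realType}.

(** The new coordinate comes first, in agreement with [tuple_of_pair]. *)
Definition cons_row n (r : R) (s : 'rV[R]_n) : 'rV[R]_n.+1 :=
  \row_i oapp (fun j => s ord0 j) r (unlift ord0 i).

Lemma dot_cons_row n (r r' : R) (s s' : 'rV[R]_n) :
  dot (cons_row r s) (cons_row r' s') = r * r' + dot s s'.
Proof.
rewrite /dot big_ord_recl !mxE unlift_none /=; congr (_ + _).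
by apply: eq_bigr => i _; rewrite !mxE liftK.
Qed.

Lemma cons_rowB n (r r' : R) (s s' : 'rV[R]_n) :
  cons_row r s - cons_row r' s' = cons_row (r - r') (s - s').
Proof.
by apply/rowP => i; rewrite !mxE; case: unlift => //= j; rewrite !mxE.
Qed.

Lemma seg_cons_row n (r r' : R) (s s' : 'rV[R]_n) t :
  seg (cons_row r s) (cons_row r' s') t =
  cons_row (r + t * (r' - r)) (seg s s' t).
Proof.
by apply/rowP => i; rewrite !mxE; case: unlift => //= j; rewrite !mxE.
Qed.

Lemma edist_cons_row n (r : R) (s s' : 'rV[R]_n) :
  edist (cons_row r s) (cons_row r s') = edist s s'.
Proof.
by rewrite /Defs.edist cons_rowB subrr /enorm dot_cons_row mulr0 add0r.
Qed.

Lemma edist_cons_row_ge n (r r' : R) (s s' : 'rV[R]_n) :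
  edist s s' <= edist (cons_row r s) (cons_row r' s').
Proof.
rewrite /Defs.edist cons_rowB -(ler_pXn2r (n := 2))// ?nnegrE ?enorm_ge0//.
by rewrite !enormK dot_cons_row lerDr -expr2 sqr_ge0.
Qed.

Lemma cons_row_ex n (x : 'rV[R]_n.+1) : exists r s, x = cons_row r s.
Proof.
exists (x ord0 ord0), (\row_j x ord0 (lift ord0 j)); apply/rowP => i.
by rewrite !mxE; case: unliftP => [j ->|->] //=; rewrite mxE.
Qed.

Definition tuple_set n (A : set 'rV[R]_n) :
    set (n.-tuple (measurableTypeR R)) :=
  [set t | A (\row_i tnth t i)].

Lemma row_of_cons n (r : R) (t : n.-tuple R) :
  \row_i tnth [tuple of r :: t] i = cons_row r (\row_i tnth t i).
Proof.
apply/rowP => i; rewrite !mxE; case: unliftP => [j ->|->] //=.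
by rewrite tnthS mxE.
Qed.

Lemma measurable_tuple_box n (q : 'rV[R]_n) (e : R) :
  measurable (tuple_set [set x | forall i, `|q ord0 i - x ord0 i| < e]).
Proof.
have -> : tuple_set [set x | forall i, `|q ord0 i - x ord0 i| < e] =
    \bigcap_(i in [set: 'I_n])
      ((fun t : n.-tuple (measurableTypeR R) => tnth t i)
        @^-1` `]q ord0 i - e, q ord0 i + e[%classic).
  apply/seteqP; split=> t /= h i => [_|].
    by have := h i; rewrite mxE/= in_itv/= distrC ltr_distl.
  by have := h i I; rewrite mxE/= in_itv/= distrC ltr_distl.
apply: fin_bigcap_measurable; first exact: finite_finset.
by move=> i _; rewrite -[X in measurable X]setTI; apply: measurable_tnth.
Qed.

(** An open set is the union of the countably many boxes with rational centre and half-side 1 / (k +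
    1) that it contains; [pickle] enumerates them. *)
Lemma measurable_open n (A : set 'rV[R]_n) : open A -> measurable (tuple_set A).
Proof.
move=> oA; pose box (q : 'rV[rat]_n) (k : nat) :=
  [set x : 'rV[R]_n | forall i, `|ratr (q ord0 i) - x ord0 i| < k.+1%:R^-1].
pose F (m : nat) : set (n.-tuple (measurableTypeR R)) :=
  if (unpickle m : option ('rV[rat]_n * nat)) is Some p then
    (if `[< box p.1 p.2 `<=` A >] then tuple_set (box p.1 p.2) else set0)
  else set0.
have -> : tuple_set A = \bigcup_m F m.
  apply/seteqP; split=> [t /= At|t [m _]]; last first.
    rewrite /F; case: unpickle => // -[q k] /=.
    by case: asboolP => // h; exact: h.
  set x := (\row_i tnth t i) in At.
  have [e e0 xA] := (open_edistP A).1 oA x At.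
  (* Two points of such a box differ by less than 2 / (k + 1) in each coordinate, hence by at most n
     times this bound in Euclidean norm. *)
  have [k ke] : exists k : nat, 2 * n%:R / k.+1%:R < e.
    pose k := Num.truncn (2 * n%:R / e); exists k.
    rewrite ltr_pdivrMr// [ltRHS]mulrC -ltr_pdivrMr//.
    by have /truncn_itv/andP[_] : 0 <= 2 * n%:R / e by rewrite divr_ge0// ltW.
  have /choice[q qP] : forall i : 'I_n, exists q : rat,
      `|ratr q - x ord0 i| < k.+1%:R^-1.
    move=> i; have k0 : (0 : R) < k.+1%:R^-1 by rewrite invr_gt0.
    have h : x ord0 i - k.+1%:R^-1 < x ord0 i + k.+1%:R^-1.
      by rewrite ltrBlDr -addrA ltrDl addr_gt0.
    have [q] := rat_in_itvoo h.
    rewrite in_itv/= => /andP[h1 h2]; exists q.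
    move: (ratr q) (k.+1%:R^-1) h1 h2 => z d h1 h2.
    by rewrite ltr_norml; lra.
  exists (pickle (\row_i q i : 'rV[rat]_n, k)) => //.
  rewrite /F pickleK /=; case: asboolP => [_|].
    by move=> i; rewrite mxE; exact: qP.
  case=> y yq; apply: xA; apply: le_lt_trans ke.
  apply: le_trans (enorm_le_norm _) _.
  rewrite [2 * _]mulrC -mulrA ler_wpM2l//.
  rewrite [leLHS]/Num.norm/= mx_normrE bigmax_le// => -[i j] _ /=.
  rewrite ord1 !mxE.
  have := qP j; have := yq j; rewrite !mxE.
  move: (ratr (q j)) (k.+1%:R^-1) => z d.
  by rewrite !ltr_norml ler_norml; lra.
apply: bigcupT_measurable => m; rewrite /F.
case: unpickle => [[q k] /=|]; last exact: measurable0.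
case: asboolP => _; last exact: measurable0.
have -> : box q k =
    [set x | forall i, `|(map_mx ratr q) ord0 i - x ord0 i| < k.+1%:R^-1].
  by apply/seteqP; split=> x /= h i; have := h i; rewrite mxE.
exact: measurable_tuple_box.
Qed.

Lemma tuple_setC n (A : set 'rV[R]_n) : tuple_set (~` A) = ~` tuple_set A.
Proof. by []. Qed.

Lemma measurable_closed n (A : set 'rV[R]_n) : closed A ->
  measurable (tuple_set A).
Proof.
move=> cA; rewrite -(setCK A) tuple_setC; apply: measurableC.
by apply: measurable_open; exact: closed_openC.
Qed.

Definition slice n (A : set 'rV[R]_n.+1) (t : n.-tuple (measurableTypeR R)) :
    set (measurableTypeR R) :=
  [set r | A (cons_row r (\row_i tnth t i))].

Lemma sliceE n (A : set 'rV[R]_n.+1) :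
  slice A = xsection (@tuple_of_pair R n @^-1` tuple_set A).
Proof.
apply/funext => t; apply/seteqP; split=> r; rewrite xsectionE /=;
  by rewrite /tuple_set /tuple_of_pair /= row_of_cons.
Qed.

Lemma lebesgueS n (A : set 'rV[R]_n.+1) :
  lebesgue A = (\int[lebesgue_tuple R n]_s lebesgue_measure (slice A s))%E.
Proof. by rewrite sliceE. Qed.

Lemma measurable_slice n (A : set 'rV[R]_n.+1) : measurable (tuple_set A) ->
  measurable_fun [set: n.-tuple (measurableTypeR R)]
    (lebesgue_measure \o slice A).
Proof.
move=> mA; rewrite sliceE; apply: measurable_fun_xsection.
by rewrite -[X in measurable X]setTI; apply: measurable_tuple_of_pair.
Qed.

(* A line parallel to the first axis that meets [A] has at most two points on
   the frontier of [A]; the other lines that meet this frontier lie over the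
   frontier of the projection of [A], and induction applies. *)
Lemma lebesgue_frontier n (A : set 'rV[R]_n) : open A ->
  convex_set (A : set (convex_lmodType 'rV[R]_n)) ->
  lebesgue (frontier A) = 0%E.
Proof.
elim: n A => [|n IH] A oA cA.
  have -> : frontier A = set0.
    apply/seteqP; split=> // x /(frontier_openP _ oA)[+ nAx].
    move=> /closure_edistP/(_ 1 ltr01)[y Ay _]; apply: nAx.
    by rewrite (_ : x = y)//; apply/rowP => -[].
  by rewrite /lebesgue (_ : [set _ | _] = set0) ?measure0.
pose P := [set s | exists r, A (cons_row r s)].
have oP : open P.
  apply/open_edistP => s [r] /((open_edistP A).1 oA)[e e0 h].
  exists e => // s' ss'.
  by exists r; apply: h; rewrite edist_cons_row.
have cP : convex_set (P : set (convex_lmodType 'rV[R]_n)).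
  apply/convex_setP => s s' t t01 [r Ar] [r' Ar'].
  by exists (r + t * (r' - r)); rewrite -seg_cons_row; apply: (convex_setP A).1.
rewrite lebesgueS.
have mF : measurable (tuple_set (frontier P)).
  exact: (measurable_closed (@closed_frontier R _ P)).
have mf := measurable_slice (measurable_closed (@closed_frontier R _ A)).
rewrite (ge0_negligible_integral mF measurableT mf _ (IH P oP cP))//.
apply: integral0_eq => t [_]; rewrite /tuple_set /=.
set s := \row_i _ => nfs.
set S := slice _ _; have [Ps|nPs] := pselect (P s); last first.
  rewrite (_ : S = set0) ?measure0//; apply/seteqP; split=> // r [clr _].
  apply: nfs; apply/frontier_openP => //; split=> //.
  apply/closure_edistP => e /((closure_edistP _ _).1 clr)[y Ay ry].
  have [r' [s' yE]] := cons_row_ex y.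
  exists s'; first by exists r'; rewrite -yE.
  by apply: le_lt_trans ry; rewrite yE; exact: edist_cons_row_ge.
have [r0 Ar0] := Ps.
(* The segment from the interior point [r0] to [r'], without its end [r'], lies in [A]; so each side
   of [r0] carries at most one frontier point. *)
have between r r' t' : 0 <= t' < 1 -> S r' -> S r -> r <> r0 + t' * (r' - r0).
  move=> t01 Sr' Sr rE; have [_] := (frontier_openP _ oA).1 Sr; apply.
  have -> : cons_row r s = seg (cons_row r0 s) (cons_row r' s) t'.
    by rewrite seg_cons_row -rE /seg subrr scaler0 addr0.
  by apply: open_convex_seg => //; have [] := Sr'.
have ratio r r' : r' - r0 != 0 -> r = r0 + (r - r0) / (r' - r0) * (r' - r0).
  by move=> h; rewrite divfK// addrC subrK.
have above r r' : S r -> S r' -> r0 < r -> r0 < r' -> r <= r'.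
  move=> Sr Sr' h h'; rewrite leNgt; apply/negP => rr'.
  apply: (between r' r ((r' - r0) / (r - r0))) => //.
    rewrite divr_ge0 ?subr_ge0 ?(ltW h) ?(ltW h')//=.
    by rewrite ltr_pdivrMr ?subr_gt0// mul1r ltrD2r.
  by apply: ratio; rewrite subr_eq0 gt_eqF.
have below r r' : S r -> S r' -> r < r0 -> r' < r0 -> r <= r'.
  move=> Sr Sr' h h'; rewrite leNgt; apply/negP => rr'.
  apply: (between r r' ((r - r0) / (r' - r0))) => //.
    rewrite -mulrNN -invrN !opprB divr_ge0 ?subr_ge0 ?(ltW h) ?(ltW h')//=.
    by rewrite ltr_pdivrMr ?subr_gt0// mul1r ltrD2l ltrN2.
  by apply: ratio; rewrite subr_eq0 lt_eqF.
have Sr0 r : S r -> r != r0.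
  move=> Sr; apply/eqP => rE; have [_] := (frontier_openP _ oA).1 Sr.
  by rewrite rE.
(* Where a side has no frontier point the default [r0] is harmless: only the inclusion of [S] in a
   finite set is wanted. *)
pose p := xget r0 [set r | S r /\ r0 < r].
pose q := xget r0 [set r | S r /\ r < r0].
apply: countable_lebesgue_measure0.
apply: (@sub_countable _ _ _ [set p; q]); last first.
  by apply: finite_set_countable; exact: finite_set2.
apply: subset_card_le => r Sr; have := Sr0 r Sr.
rewrite neq_lt => /orP[rr0|rr0]; [right|left].
  have [Sq qr0] : [set r | S r /\ r < r0] q by apply: (@xgetPex _ r0); exists r.
  by apply/eqP; rewrite eq_le !below.
have [Sp pr0] : [set r | S r /\ r0 < r] p by apply: (@xgetPex _ r0); exists r.
by apply/eqP; rewrite eq_le !above.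
Qed.

Definition cube n (M : R) : set 'rV[R]_n :=
  [set x | forall i, `|x ord0 i| <= M].

Lemma measurable_cube n M : measurable (tuple_set (@cube n M)).
Proof.
have -> : tuple_set (@cube n M) =
    \bigcap_(i in [set: 'I_n])
      ((fun t : n.-tuple (measurableTypeR R) => tnth t i)
        @^-1` `[- M, M]%classic).
  apply/seteqP; split=> t /= h i => [_|].
    by have := h i; rewrite mxE/= in_itv/= ler_norml.
  by have := h i I; rewrite mxE/= in_itv/= ler_norml.
apply: fin_bigcap_measurable; first exact: finite_finset.
by move=> i _; rewrite -[X in measurable X]setTI; apply: measurable_tnth.
Qed.

(** Supplies the finite measure that continuity from above requires. *)
Lemma lebesgue_cube_lty n M : (lebesgue (@cube n M) < +oo)%E.
Proof.
elim: n => [|n IH]; first by rewrite /lebesgue/= /dirac ltry.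
have E : @tuple_of_pair R n @^-1` tuple_set (@cube n.+1 M) =
    tuple_set (@cube n M) `*` `[- M, M]%classic.
  apply/seteqP; split=> -[t r];
    rewrite /tuple_set /tuple_of_pair /= row_of_cons.
    move=> h; split=> [i|].
      by have := h (lift ord0 i); rewrite [cons_row _ _ _ _]mxE liftK.
    have := h ord0; rewrite [cons_row _ _ _ _]mxE unlift_none /=.
    by rewrite in_itv/= ler_norml.
  rewrite in_itv/= -ler_norml => -[h1 h2] i.
  by rewrite mxE; case: unliftP => [j _|_]; [exact: h1|exact: h2].
rewrite -[lebesgue _]/((lebesgue_tuple R n \x lebesgue_measure)%E
  (@tuple_of_pair R n @^-1` tuple_set (@cube n.+1 M))) E.
rewrite product_measure1E//; last exact: measurable_cube.
apply: lte_mul_pinfty => //; first by rewrite ge0_fin_numE.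
pose I : set R := `[- M, M]%classic.
have : (lebesgue_measure I < +oo)%E.
  by rewrite /I lebesgue_measure_itv; case: ifP => // _; rewrite -EFinB ltry.
exact.
Qed.

Lemma bounded_cube n (A : set 'rV[R]_n) : bounded_set A ->
  exists M, A `<=` @cube n M.
Proof.
move=> /bounded_enormP[M _ AM]; exists M => x /AM xM i.
exact: le_trans (norm_coord_enorm _ _) xM.
Qed.

(* The image of [A] under the homothety of center [x0] and ratio [1 + t]. *)
Definition dilation n (A : set 'rV[R]_n) x0 (t : R) : set 'rV[R]_n :=
  [set x | A (seg x0 x (1 + t)^-1)].

Lemma open_dilation n (A : set 'rV[R]_n) x0 t : 0 < t -> open A ->
  open (dilation A x0 t).
Proof.
move=> t0 /open_edistP oA; apply/open_edistP => x /oA[e e0 h].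
exists e => // y xy; apply: h; apply: le_lt_trans xy.
have -> : edist (seg x0 x (1 + t)^-1) (seg x0 y (1 + t)^-1) =
    (1 + t)^-1 * edist x y.
  have h : 0 <= (1 + t)^-1 by rewrite invr_ge0; lra.
  rewrite /Defs.edist -[in RHS](ger0_norm h) -enormZ; congr enorm.
  by apply/rowP => i; rewrite !mxE; ring.
rewrite ler_piMl ?enorm_ge0// invf_le1; lra.
Qed.

Lemma dilation_sub n (A : set 'rV[R]_n) x0 s t :
  convex_set (A : set (convex_lmodType 'rV[R]_n)) -> A x0 -> 0 < s -> s <= t ->
  dilation A x0 s `<=` dilation A x0 t.
Proof.
move=> /convex_setP cA Ax0 s0 st x /= Ax; rewrite /dilation /=.
have -> : seg x0 x (1 + t)^-1 =
    seg x0 (seg x0 x (1 + s)^-1) ((1 + s) / (1 + t)).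
  rewrite /seg addrAC subrr add0r scalerA [_ / _ * _]mulrAC divff ?mul1r//.
  by rewrite gt_eqF//; lra.
by apply: cA => //; rewrite divr_ge0/= ?ler_pdivrMr ?mul1r; lra.
Qed.

Lemma bounded_dilation n (A : set 'rV[R]_n) x0 t : 0 < t -> bounded_set A ->
  bounded_set (dilation A x0 t).
Proof.
move=> t0 /bounded_enormP[M M0 AM]; apply/bounded_enormP.
have x00 := enorm_ge0 x0.
exists (t * enorm x0 + (1 + t) * M); first by nra.
move=> x /AM xM.
have -> : x = (- t) *: x0 + (1 + t) *: seg x0 x (1 + t)^-1.
  by apply/rowP => i; rewrite !mxE; field; rewrite gt_eqF//; lra.
apply: le_trans (enormD _ _) _.
rewrite !enormZ normrN !gtr0_norm//; last by lra.
by rewrite lerD2l ler_pM2l//; lra.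
Qed.

Lemma dilation_closure n (A : set 'rV[R]_n) x0 x :
  (forall m : nat, dilation A x0 m.+1%:R^-1 x) -> closure A x.
Proof.
move=> h; apply/closure_edistP => e e0.
pose m := Num.truncn (edist x0 x / e).
have me : edist x0 x < e * m.+1%:R.
  rewrite mulrC -ltr_pdivrMr//.
  by have /truncn_itv/andP[_] : 0 <= edist x0 x / e
    by rewrite divr_ge0 ?enorm_ge0// ltW.
exists (seg x0 x (1 + m.+1%:R^-1)^-1); first exact: h.
rewrite -{1}(seg1 x0 x) edist_seg; move: (m.+1%:R) (ltr0Sn R m) me => d d0 me.
have -> : 1 - (1 + d^-1)^-1 = (d + 1)^-1.
  by field; rewrite !gt_eqF//; lra.
rewrite gtr0_norm ?invr_gt0; last by lra.
rewrite mulrC ltr_pdivrMr; last by lra.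
have := enorm_ge0 (x0 - x); nra.
Qed.

(** The sets [B k] need not decrease, so they are compared with the dilations of ratio 1 + 1 / (m +
    1), which do. What these have in common outside [A] lies in the null frontier, and continuity
    from above applies. *)
Lemma lebesgue_dilation_cvg n (A : set 'rV[R]_n) x0 (t : nat -> R)
    (B : nat -> set 'rV[R]_n) : open A -> bounded_set A ->
  convex_set (A : set (convex_lmodType 'rV[R]_n)) -> A x0 ->
  (forall k, (0 < k)%N -> 0 < t k) -> t k @[k --> \oo] --> (0 : R) ->
  (forall k, (0 < k)%N -> open (B k)) ->
  (forall k, (0 < k)%N -> B k `<=` dilation A x0 (t k)) ->
  lebesgue (B k `\` A) @[k --> \oo] --> 0%E.
Proof.
move=> oA bA cA Ax0 t0 tcvg oB BA.
pose F (m : nat) := tuple_set (dilation A x0 m.+1%:R^-1 `\` A).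
have m0 (m : nat) : 0 < m.+1%:R^-1 :> R by rewrite invr_gt0.
have mD (C : set 'rV[R]_n) : open C -> measurable (tuple_set (C `\` A)).
  by move=> oC; rewrite /tuple_set; apply: measurableD; exact: measurable_open.
have mF m : measurable (F m) by apply: mD; exact: open_dilation.
have Ffin : (lebesgue_tuple R n (F 0%N) < +oo)%E.
  have [M AM] := bounded_cube (bounded_dilation x0 (m0 0%N) bA).
  apply: le_lt_trans (lebesgue_cube_lty n M).
  apply: le_measure; rewrite ?inE//; first exact: measurable_cube.
  by move=> u [/AM].
have Fcap : lebesgue_tuple R n (\bigcap_m F m) = 0%E.
  apply: (subset_measure0 (B := tuple_set (frontier A))).
  - exact: bigcapT_measurable.
  - exact: (measurable_closed (@closed_frontier R _ A)).
  - move=> u h; apply/frontier_openP => //; split; last by have [] := h 0%N I.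
    by apply: (@dilation_closure _ _ x0) => m; have [] := h m I.
  - exact: lebesgue_frontier.
have Fdec : nonincreasing_seq F.
  apply/nonincreasing_seqP => m; rewrite subsetEset => u [h1 h2]; split => //.
  by apply: dilation_sub h1 => //; rewrite lef_pV2 ?posrE// ler_nat.
have := nonincreasing_cvg_mu Ffin mF (bigcapT_measurable mF) Fdec.
rewrite Fcap => Fcvg.
have small e : 0 < e -> \forall k \near \oo, (lebesgue (B k `\` A) < e%:E)%E.
  move=> e0; have /fine_cvgP[Ffinite /cvgr_lt/(_ e e0) Fe] := Fcvg.
  have [m Fm] : exists m, (lebesgue_tuple R n (F m) < e%:E)%E.
    near \oo => m; exists m; rewrite -[ltLHS]fineK; last by near: m.
    by rewrite lte_fin; near: m.
  near=> k; apply: le_lt_trans Fm.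
  have k0 : (0 < k)%N by near: k; exists 1%N.
  apply: le_measure; rewrite ?inE//; first by apply: mD; exact: oB.
  move=> u [Bu nAu]; split => //; apply: dilation_sub (BA _ k0 _ Bu) => //.
    exact: t0.
  by near: k; apply: (cvgr_le _ tcvg).
have ge0 k : (0 <= lebesgue (B k `\` A))%E by exact: measure_ge0.
apply/fine_cvgP; split.
  near=> k; rewrite ge0_fin_numE// (lt_trans (y := 1%:E)) ?ltry//.
  by near: k; exact: small.
apply/cvgrPdist_lt => e e0; near=> k.
have lt_e : (lebesgue (B k `\` A) < e%:E)%E by near: k; exact: small.
rewrite sub0r normrN /= ger0_norm ?fine_ge0// -lte_fin fineK//.
by rewrite ge0_fin_numE// (lt_trans lt_e)// ltry.
Unshelve. all: by end_near. Qed.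

End TupleMeasure.

(** * The approximating domain and datum, diameters and boundary distances *)

Section Approximation.
Context {R : realType} {N : nat}.
Implicit Types (Omega : set 'rV[R]_N) (phi f : 'rV[R]_N -> R).
Implicit Types (x y : 'rV[R]_N) (F : 'rV[R]_N -> 'rV[R]_N).

(** The subgradient inequalities at the intermediate point are averaged with the weights of the
    segment, and their linear terms cancel. *)
Lemma subgradient_seg f F L x y s : strong_subgradient f F L -> 0 <= s <= 1 ->
  f (seg x y s) <= (1 - s) * f x + s * f y.
Proof.
move=> fF /andP[s0 s1]; set z := seg x y s.
have h1 := subgradient_le x z fF; have h2 := subgradient_le y z fF.
have : (1 - s) * dot (F z) (x - z) + s * dot (F z) (y - z) = 0.
  rewrite -!dotZr -dotDr (_ : _ + _ = 0) ?dot0r//.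
  by apply/rowP => i; rewrite /z !mxE; ring.
nra.
Qed.

Lemma elipschitz_le L L' f : L <= L' -> elipschitz L f -> elipschitz L' f.
Proof.
by move=> LL' fL x y; rewrite (le_trans (fL x y))// ler_wpM2r// enorm_ge0.
Qed.

Lemma elipschitzN L f : elipschitz L f -> elipschitz L (fun x => - f x).
Proof. by move=> fL x y; rewrite -opprD normrN; exact: fL. Qed.

Lemma elipschitz_max L f g : elipschitz L f -> elipschitz L g ->
  elipschitz L (fun x => Num.max (f x) (g x)).
Proof.
move=> fL gL x y; move: (fL x y) (gL x y); rewrite !ler_norml.
by case: (leP (f x) (g x)); case: (leP (f y) (g y));
  move=> ? ? /andP[? ?] /andP[? ?]; apply/andP; split; lra.
Qed.

Lemma elipschitz_min L f g : elipschitz L f -> elipschitz L g ->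
  elipschitz L (fun x => Num.min (f x) (g x)).
Proof.
move=> fL gL x y; move: (fL x y) (gL x y); rewrite !ler_norml.
by case: (leP (f x) (g x)); case: (leP (f y) (g y));
  move=> ? ? /andP[? ?] /andP[? ?]; apply/andP; split; lra.
Qed.

Lemma sublevel_open f L : elipschitz L f -> open [set x | f x < 0].
Proof.
move=> fL; have -> : [set x | f x < 0] = f @^-1` [set r | r < 0] by [].
apply: open_comp; last exact: open_lt.
by move=> x _; exact: (elipschitz_continuous fL).
Qed.

Lemma sublevel_frontier f L x : elipschitz L f ->
  frontier [set x | f x < 0] x -> f x = 0.
Proof.
move=> fL fx; have [/closure_edistP clx /negP] :=
  (frontier_openP x (sublevel_open fL)).1 fx.
have fc : {for x, continuous f} by exact: (elipschitz_continuous fL).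
rewrite -leNgt => fx0; apply/eqP; rewrite eq_le fx0 andbT leNgt; apply/negP.
move=> /((continuous_edistP _ _).1 fc)[d d0 fd].
have [y /= fy xy] := clx d d0.
by have := fd y xy; rewrite ltr_norml => /andP[_]; lra.
Qed.

Lemma sublevel_uniformly_convex f F L x0 : smooth_expr f ->
  strong_subgradient f F L -> 0 < L -> f x0 < 0 ->
  bounded_set [set x | f x < 0] -> smooth_uniformly_convex [set x | f x < 0].
Proof.
move=> sf fF L0 fx0 bf; have fL := subgradient_elipschitz fF.
have oO := sublevel_open fL.
split=> //.
- apply/convex_setP => x y t t01 /= fx fy.
  have := subgradient_seg x y fF t01; move: t01 => /andP[t0 t1].
  move=> /le_lt_trans; apply; have [->|t1'] := eqVneq t 1.
    by rewrite subrr mul0r add0r mul1r.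
  have : t < 1 by rewrite lt_neqAle t1'.
  nra.
(* Where [f] exceeds [f x0] its gradient cannot vanish, since a zero subgradient would mark a global
   minimum. *)
- move=> y fy; exists [set z | f x0 < f z], f; split.
  + have -> : [set z | f x0 < f z] = f @^-1` [set r | f x0 < r] by [].
    apply: open_comp; last exact: open_gt.
    by move=> x _; exact: (elipschitz_continuous fL).
  + by rewrite /= (sublevel_frontier fL fy).
  + exact: smooth_expr_smooth.
  + move=> x /= fx.
    rewrite (subgradient_grad fF (smooth_expr_smooth (U := setT) sf))//.
    apply/eqP => Fx0; have := subgradient_le x0 x fF.
    by rewrite Fx0 dot0l addr0 leNgt fx.
  + by apply/seteqP; split=> x [h1 h2].
- have [M M0 OM] :=
    (bounded_enormP _).1 (compact_bounded (closed_bounded_compact bf)).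
  (* [principal_curvature_ge] with G = F y gives 2 m <= kappa |F y|, and |F y| <= L. *)
  have [m m0 fm] := fF.2 M; exists (2 * m / L).
    by rewrite divr_gt0// mulr_gt0.
  move=> y kappa fy pc; have cly : closure [set x | f x < 0] y by have [] := fy.
  have supp x : [set x | f x < 0] x ->
      dot (F y) (x - y) + m * dot (x - y) (x - y) <= 0.
    move=> fx; have := fm x y (OM _ (subset_closure fx)) (OM _ cly).
    by rewrite (sublevel_frontier fL fy); move: fx => /=; lra.
  have := principal_curvature_ge m0 supp cly pc.
  have FL := fF.1 y; have F0 := enorm_ge0 (F y); rewrite ler_pdivrMr//.
  by have [k0|k0] := leP kappa 0; nra.
Qed.

Lemma approximation Omega K phi x0 t : (0 < N)%N -> open Omega ->
  bounded_set Omega ->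
  convex_set (Omega : set (convex_lmodType 'rV[R]_N)) -> Omega x0 -> 0 < K ->
  bounded_slope_condition Omega K phi -> 0 < t ->
  exists Omegat phit,
    [/\ smooth_uniformly_convex Omegat /\ elipschitz (K + 1) phit,
      closure Omega `<=` Omegat, Omegat `<=` dilation Omega x0 t,
      smooth_on_frontier Omegat phit /\
        bounded_slope_condition Omegat (K + 2) phit &
      forall x, frontier Omega x -> phit x = phi x].
Proof.
move=> N0 oO bO cO Ox0 K0 bsc t0.
have [gl [Gl [gu [Gu [[sl su] [subl subu] below above]]]]] :=
  barriers N0 oO bO cO Ox0 bsc t0.
pose w x := gl x + gu x; pose W x := Gl x + Gu x.
have wW : strong_subgradient w W (K + 1 + (K + 1)) := subgradientD subl subu.
have wL := subgradient_elipschitz wW.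
have w_frontier x : frontier Omega x -> w x < 0.
  by move=> /below[h1 h2]; rewrite /w; lra.
have v0 := @const_mx1_neq0 R N N0.
have w_in x : Omega x -> w x < 0.
  (* In such a direction [w] does not fall below [w x], and the ray reaches the boundary, where [w]
     is negative. Either the vector with all coordinates 1 or its opposite qualifies. *)
  move=> Ox; have ray v : v != 0 -> 0 <= dot (W x) v -> w x < 0.
    move=> vn0 Wv; have [s s0 /w_frontier] := ray_exit oO bO Ox vn0.
    apply: le_lt_trans; have := subgradient_le (x + s *: v) x wW.
    rewrite (addrAC x) subrr add0r dotZr; nra.
  have [/(ray _ v0)//|h] := leP 0 (dot (W x) (const_mx 1)).
  by apply: (ray (- const_mx 1)); rewrite ?oppr_eq0// dotNr oppr_ge0 ltW.
pose Omegat := [set x | w x < 0].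
have clO : closure Omega `<=` Omegat.
  move=> x clx; have [/w_in//|nOx] := pselect (Omega x).
  exact/w_frontier/frontier_openP.
(* If [x] is outside the dilation, the segment from [x0] to [x] crosses the dilated boundary, where
   [w] is positive; convexity forbids this when [w] is negative at both ends. *)
have Odil : Omegat `<=` dilation Omega x0 t.
  move=> x wx; apply: contrapT => nx; rewrite /Omegat/= in wx.
  have [s /andP[s0 s1] /above] := exit_point oO Ox0 nx.
  have -> : seg x0 (seg x0 (seg x0 x (1 + t)^-1) s) (1 + t) = seg x0 x s.
    by apply/rowP => i; rewrite !mxE; field; rewrite gt_eqF//; lra.
  rewrite -/(w _) => wpos.
  have := @subgradient_seg _ _ _ x0 x s wW; rewrite ltW// s1 => /(_ isT).
  have := w_in _ Ox0; nra.
have bOt : bounded_set Omegat.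
  have /bounded_enormP[M M0 DM] := bounded_dilation x0 t0 bO.
  by apply/bounded_enormP; exists M => // x /Odil/DM.
have [a fa] := frontier_nonempty N0 oO bO Ox0.
have [mcL mcE] := mcshaneP (ltW K0) fa
  (fun x y fx fy => bounded_slope_lipschitz bsc fx fy).
pose phit x :=
  Num.max (gl x) (Num.min (- gu x) (mcshane (frontier Omega) K phi x)).
have phitE x : frontier Omegat x -> phit x = gl x /\ phit x = - gu x.
  move=> /(sublevel_frontier wL); rewrite /w => wx.
  suff : phit x = gl x by move=> ->; split=> //; lra.
  by rewrite /phit max_l// ge_min; apply/orP; left; lra.
exists Omegat, phit; split=> //.
- split.
    apply: (@sublevel_uniformly_convex _ _ _ x0 (smooth_add sl su) wW) => //.
      lra.
    exact: w_in.
  apply: elipschitz_max; first exact: (subgradient_elipschitz subl).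
  apply: elipschitz_min; first exact: elipschitzN (subgradient_elipschitz subu).
  by apply: elipschitz_le mcL; lra.
- split.
    move=> y _; exists setT, gl; split=> //; first exact: openT.
      exact: smooth_expr_smooth.
    by move=> x _ /phitE[->].
  move=> y /phitE[yl yu]; exists (Gl y), (- Gu y); split.
  + by rewrite (le_trans (subl.1 y))//; lra.
  + by rewrite enormN (le_trans (subu.1 y))//; lra.
  + move=> x /phitE[xl xu]; apply/andP; split.
      by rewrite xl yl; exact: (subgradient_le x y subl).
    by rewrite xu yu dotNl; have := subgradient_le x y subu; lra.
- move=> x fx; have [h1 h2] := below x fx.
  rewrite /phit (mcE _ fx) (_ : Num.min _ _ = phi x).
    by rewrite max_r// ltW.
  by rewrite min_r//; lra.
Qed.

Lemma has_ubound_edist (A : set 'rV[R]_N) x : bounded_set A ->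
  has_ubound [set edist x y | y in A].
Proof.
move=> /bounded_enormP[M M0 AM]; exists (enorm x + M) => _ [y Ay <-].
by apply: le_trans (enormD _ _) _; rewrite enormN lerD2l AM.
Qed.

Lemma has_ubound_diam (A : set 'rV[R]_N) : bounded_set A ->
  has_ubound [set edist p.1 p.2 | p in A `*` A].
Proof.
move=> /bounded_enormP[M M0 AM]; exists (M + M) => _ [[x y] [/= Ax Ay] <-].
by apply: le_trans (enormD _ _) _; rewrite enormN lerD ?AM.
Qed.

Lemma diam_dilation Omega (B : set 'rV[R]_N) x0 t : bounded_set Omega ->
  0 < t -> B !=set0 -> B `<=` dilation Omega x0 t ->
  diam B <= (1 + t) * diam Omega.
Proof.
move=> bO t0 [b Bb] BD; have t1 : 0 < 1 + t by lra.
apply: ge_sup; first by exists (edist b b), (b, b).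
move=> _ [[x y] [/= /BD Dx /BD Dy] <-].
have -> : edist x y =
    (1 + t) * edist (seg x0 x (1 + t)^-1) (seg x0 y (1 + t)^-1).
  rewrite /Defs.edist -{1}(gtr0_norm t1) -enormZ; congr enorm.
  by apply/rowP => i; rewrite !mxE; field; rewrite gt_eqF.
rewrite ler_pM2l//; apply: (ub_le_sup (has_ubound_diam bO)).
by exists (seg x0 x (1 + t)^-1, seg x0 y (1 + t)^-1).
Qed.

Lemma diam_ge0 Omega x : bounded_set Omega -> Omega x -> 0 <= diam Omega.
Proof.
move=> bO Ox; apply: (ub_le_sup (has_ubound_diam bO)).
by exists (x, x); rewrite //= edistxx.
Qed.

Lemma beta_gt0 Omega x0 : (0 < N)%N -> open Omega -> bounded_set Omega ->
  Omega x0 -> 0 < beta Omega x0.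
Proof.
move=> N0 oO bO Ox0.
have [a fa] := frontier_nonempty N0 oO bO Ox0.
have [r r0 Or] := (open_edistP _).1 oO _ Ox0.
have far y : frontier Omega y -> r <= edist x0 y.
  move=> /(frontier_openP _ oO)[_ nOy]; rewrite leNgt; apply/negP.
  by move=> /Or.
rewrite mulr_gt0 ?invr_gt0// divr_gt0//.
  apply: (lt_le_trans r0); apply: le_trans (far _ fa) _.
  apply: (ub_le_sup (has_ubound_edist _ _)); last by exists a.
  exact: (compact_bounded (compact_frontier bO)).
apply: (lt_le_trans r0); apply: lb_le_inf; first by exists (edist x0 a), a.
by move=> _ [y fy <-]; exact: far.
Qed.

Lemma min_dist_ge0 x (A : set 'rV[R]_N) : A !=set0 -> 0 <= min_dist x A.
Proof.
move=> [y Ay]; apply: lb_le_inf; first by exists (edist x y), y.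
by move=> _ [z _ <-]; exact: enorm_ge0.
Qed.

(** Moving from [y] away from [x0], the frontier of [B] is met no later than at [seg x0 y (1 + t)],
    whose distance from [y] is t |x0 - y|. *)
Lemma max_min_dist_le Omega (B : set 'rV[R]_N) x0 t a : open Omega ->
  bounded_set Omega -> open B -> closure Omega `<=` B ->
  B `<=` dilation Omega x0 t -> 0 < t -> frontier Omega a ->
  0 <= max_min_dist (frontier Omega) (frontier B)
    <= t * max_dist x0 (frontier Omega).
Proof.
move=> oO bO oB OB BD t0 fa; have t1 : 0 < 1 + t by lra.
have near y : frontier Omega y -> exists2 y', frontier B y' &
    edist y y' <= t * max_dist x0 (frontier Omega).
  move=> fy; have [cly nOy] := (frontier_openP _ oO).1 fy.
  have nB : ~ B (seg x0 y (1 + t)).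
    move=> /BD; rewrite /dilation /= (_ : seg _ _ _ = y)//.
    by apply/rowP => i; rewrite !mxE; field; rewrite gt_eqF.
  have [s /andP[s0 s1] fs] := exit_point oB (OB _ cly) nB.
  eexists; first exact: fs.
  rewrite -{1}(seg0 y (seg x0 y (1 + t))) edist_seg sub0r normrN gtr0_norm//.
  have -> : edist y (seg x0 y (1 + t)) = t * edist x0 y.
    rewrite -{1}(seg1 x0 y) edist_seg opprD addrA subrr add0r normrN.
    by rewrite gtr0_norm.
  apply: (@le_trans _ _ (t * edist x0 y)).
    by rewrite ler_piMl// mulr_ge0 ?enorm_ge0// ltW.
  rewrite ler_pM2l//.
  apply: (ub_le_sup (has_ubound_edist _ _)); last by exists y.
  exact: (compact_bounded (compact_frontier bO)).
have neB : frontier B !=set0 by have [b fb _] := near a fa; exists b.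
have ub : ubound [set min_dist y (frontier B) | y in frontier Omega]
    (t * max_dist x0 (frontier Omega)).
  move=> _ [y /near[y' fy' yy'] <-]; apply: le_trans yy'.
  apply: ge_inf; last by exists y'.
  by exists 0 => _ [z _ <-]; exact: enorm_ge0.
apply/andP; split; last first.
  by apply: ge_sup => //; exists (min_dist a (frontier B)), a.
apply: le_trans (min_dist_ge0 a neB) _.
by apply: ub_le_sup; [exists (t * max_dist x0 (frontier Omega))|exists a].
Qed.

End Approximation.

(** * Choice of the dilation ratios and conclusion *)

Lemma cvg_div_nat (R : realType) (c : R) : c / k%:R @[k --> \oo] --> (0 : R).
Proof.
rewrite -(mulr0 c); apply: cvgM; first exact: cvg_cst.
apply/gtr0_cvgV0; last exact: cvgr_idn.
by near=> k; rewrite ltr0n; near: k; exists 1%N.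
Unshelve. all: by end_near. Qed.

Theorem lemma2p6 (R : realType) (N : nat) (Omega : set 'rV[R]_N)
    (x0 : 'rV[R]_N) (K : R) (phi : 'rV[R]_N -> R)
    (hN : (2 <= N)%N)
    (hopen : open Omega) (hbounded : bounded_set Omega)
    (hconvex : convex_set (Omega : set (convex_lmodType 'rV[R]_N)))
    (hx0 : Omega x0) (hK : 0 < K)
    (hphi : bounded_slope_condition Omega K phi) :
  exists (Omegak : nat -> set 'rV[R]_N) (phik : nat -> 'rV[R]_N -> R),
    [/\ forall k : nat, (0 < k)%N ->
          smooth_uniformly_convex (Omegak k) /\ elipschitz (K + 1) (phik k),
        [/\ forall k : nat, (0 < k)%N -> closure Omega `<=` Omegak k,
            forall k : nat, (0 < k)%N ->
              diam (Omegak k) <= diam Omega + 8 * beta Omega x0 / k%:R,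
            lebesgue (Omegak k `\` Omega) @[k --> \oo] --> 0%E &
            max_min_dist (frontier Omega) (frontier (Omegak k))
              @[k --> \oo] --> (0 : R)],
        forall k : nat, (0 < k)%N ->
          smooth_on_frontier (Omegak k) (phik k) /\
          bounded_slope_condition (Omegak k) (K + 2) (phik k) &
        forall k : nat, (0 < k)%N ->
          forall x, frontier Omega x -> phik k x = phi x].
Proof.
have N0 : (0 < N)%N by exact: ltn_trans hN.
have d0 := diam_ge0 hbounded hx0; have b0 := beta_gt0 N0 hopen hbounded hx0.
(* The dilation adds at most t diam(Omega) to the diameter, and this [t] keeps that below 8 beta /
   k; the + 1 makes the denominator positive from [d0] alone. *)
pose t (k : nat) := 8 * beta Omega x0 / (diam Omega + 1) / k%:R.
have t0 k : (0 < k)%N -> 0 < t k.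
  move=> k0; have d1 : 0 < diam Omega + 1 by lra.
  by rewrite /t !divr_gt0 ?ltr0n// mulr_gt0.
have tcvg : t k @[k --> \oo] --> (0 : R) by exact: cvg_div_nat.
have /choice[A AP] : forall k, exists A : set 'rV[R]_N * ('rV[R]_N -> R),
    (0 < k)%N -> [/\ smooth_uniformly_convex A.1 /\ elipschitz (K + 1) A.2,
      closure Omega `<=` A.1, A.1 `<=` dilation Omega x0 (t k),
      smooth_on_frontier A.1 A.2 /\ bounded_slope_condition A.1 (K + 2) A.2 &
      forall x, frontier Omega x -> A.2 x = phi x].
  (* The index 0 is outside the range of the sequences and receives a dummy value. *)
  move=> [|k]; first by exists (set0, phi).
  have [Ok [phik H]] :=
    approximation N0 hopen hbounded hconvex hx0 hK hphi (t0 k.+1 isT).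
  by exists (Ok, phik).
have oA k : (0 < k)%N -> open (A k).1 by move=> /AP[[[]]].
have AD k : (0 < k)%N -> (A k).1 `<=` dilation Omega x0 (t k) by move=> /AP[].
exists (fun k => (A k).1), (fun k => (A k).2); split; try by move=> k /AP[].
split; first by move=> k /AP[].
- move=> k k0; have [_ /(_ _ (subset_closure hx0)) Ax0 AkD _ _] := AP k k0.
  have ne : (A k).1 !=set0 by exists x0.
  apply: le_trans (diam_dilation hbounded (t0 k k0) ne AkD) _.
  rewrite mulrDl mul1r lerD2l /t mulrAC ler_wpM2r ?invr_ge0//.
  by rewrite mulrAC ler_pdivrMr ?ltr_wpDl// ler_wpM2l ?lerDl// mulr_ge0 ?ltW.
- exact: (lebesgue_dilation_cvg hopen hbounded hconvex hx0 t0 tcvg oA AD).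
- have [a fa] := frontier_nonempty N0 hopen hbounded hx0.
  have bnd k : (0 < k)%N ->
      0 <= max_min_dist (frontier Omega) (frontier (A k).1)
        <= t k * max_dist x0 (frontier Omega).
    move=> k0; have [_ clA AkD _ _] := AP k k0.
    exact: max_min_dist_le hopen hbounded (oA k k0) clA AkD (t0 k k0) fa.
  apply: (@squeeze_cvgr _ _ _ _ (cst 0)
    (fun k => t k * max_dist x0 (frontier Omega))).
  + by near=> k; apply: bnd; near: k; exists 1%N.
  + exact: cvg_cst.
  + by rewrite -[X in _ --> X](mul0r (max_dist x0 (frontier Omega)));
      apply: cvgM tcvg _; exact: cvg_cst.
Unshelve. all: by end_near. Qed.
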